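(* Let $M$ be the surface obtained, for some $\mathcal{C}^\infty$ structure on the closed long ray $\mathsf{R}$, from the component $T^+$ of nonzero ''positive'' tangent vectors of the tangent bundle of $\mathsf{R}$ by taking the quotient by the fiberwise action of $\mathbb{Z}$ generated by multiplication by $2$ and collapsing the fiber above $0$ to a point. Then $[M,\mathsf{R}]\simeq\{0,1\}$, i.e. there are exactly two homotopy classes of continuous maps $M\to\mathsf{R}$.
   Context: $[X,Y]$ denotes the set of (free) homotopy classes of continuous maps $X\to Y$. $\mathsf{R}=\omega_1\times[0,1[$ is the closed long ray, with the lexicographic order and the order topology; it is a non metrizable $1$-manifold with boundary point $0$ and can be given a $\mathcal{C}^\infty$ structure. Construction of $M$: fix any $\mathcal{C}^\infty$ structure on $\mathsf{R}$, let $T$ be the tangent bundle of $\mathsf{R}$ and $T_0\subset T$ its $0$-section. $T\setminus T_0$ is the disjoint union of two homeomorphic components $T^+$ and $T^-$ (vectors pointing in the increasing, respectively decreasing, direction). $\mathbb{Z}$ acts on the fibers of $T^+$ by $(x,i)\mapsto 2^i\cdot x$. $M$ is the quotient $T^+/\mathbb{Z}$ in which, moreover, all points of the fiber above $0\in\mathsf{R}$ are identified to one point. *)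

(* Defs.v *)
From HB Require Import structures.
From mathcomp Require Import all_boot all_order all_algebra.
From mathcomp Require Import all_classical all_reals all_analysis.
From mathcomp Require Import wochoice.

Set Implicit Arguments.
Unset Strict Implicit.
Unset Printing Implicit Defensive.

Import Order.TTheory GRing.Theory Num.Theory.
Import numFieldNormedType.Exports.

Local Open Scope classical_set_scope.
Local Open Scope ring_scope.
Local Open Scope quotient_scope.

(** * The ordinal omega_1 *)

(* These three properties characterize omega_1 up to a (unique) order
   isomorphism. *)
Record is_omega1 d (W : orderType d) : Prop := {
  omega1_wo : well_order (<=%O : rel W);
  omega1_uncountable : ~ countable [set: W];
  omega1_segment : forall x : W, countable [set y : W | (y < x)%O] }.

Lemma uncountable_natbool : ~ countable [set: nat -> bool].
Proof.
move=> /countable_injP[f finj].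
pose D n := `[< exists2 g : nat -> bool, f g = n & g n = false >].
have DF : D (f D) = false.
  apply/negP => DT; have /asboolP[g fg gF] := DT.
  have gD : g = D by apply: finj; rewrite ?inE.
  by move: gF; rewrite gD => gF; rewrite gF in DT.
by have /asboolP := DF; apply; exists D.
Qed.

Lemma omega1_exists d : exists W : orderType d, is_omega1 W.
Proof.
pose T0 : choiceType := (nat -> bool)%type.
have [R Rwo] := well_ordering_principle T0.
have Rwo' : wo_chain R predT by move=> A _; exact: Rwo.
have Rtot : total R by move=> x y; exact: (wo_chainW Rwo').
have Rxx : reflexive R by move=> x; exact: (wo_chain_reflexive Rwo').
have Ranti : antisymmetric R by move=> x y; exact: (wo_chain_antisymmetric Rwo').
have Rtr : transitive R.
  move=> y x z xy yz.
  have [m [[mA mle] _]] : exists! m, minimum_of R [pred t | t \in [:: x; y; z]] m.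
    by apply: Rwo; exists x; rewrite !inE eqxx.
  move: mA; rewrite !inE => /or3P[] /eqP mE.
  - by move: (mle z); rewrite mE; apply; rewrite !inE eqxx !orbT.
  - suff -> : x = y by [].
    by apply: Ranti; rewrite xy -mE mle// !inE eqxx.
  - suff <- : y = z by [].
    by apply: Ranti; rewrite yz -mE mle// !inE eqxx orbT.
pose P : pred T0 := fun x => `[< countable [set y : T0 | R y x] >].
pose W : choiceType := {x : T0 | P x}.
pose le : rel W := fun u v => R (val u) (val v).
pose lt : rel W := fun u v => (v != u) && le u v.
have le_anti : antisymmetric le by move=> u v /Ranti /val_inj.
have le_tr : transitive le by move=> v u w; exact: Rtr.
have le_tot : total le by move=> u v; exact: Rtot.
pose O := Order.isOrder.Build d W (fun _ _ => erefl) (fun _ _ => erefl)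
  (fun _ _ => erefl) le_anti le_tr le_tot.
pose Wo : orderType d := HB.pack (Choice.sort W) O.
exists Wo; split.
- move=> A [x Ax].
  pose B : pred T0 := fun t => `[< exists2 u : W, A u & val u = t >].
  have [|m [[/asboolP[u Au um] mle] _]] := Rwo B.
    by exists (val (x : W)); apply/asboolP; exists x.
  have uA : minimum_of (<=%O : rel Wo) A u.
    split => // v Av; change (R (val (u : W)) (val (v : W))); rewrite um.
    by apply: mle; apply/asboolP; exists v.
  exists u; split=> // v [Av vle]; apply/le_anti.
  by apply/andP; split; [exact: uA.2|exact: vle].
- move=> cW.
  have cP : countable [set t : T0 | P t].
    move: cW => /countable_injP[f finj]; apply/countable_injP.
    exists (fun t => if insub t is Some u then f (u : W) else 0%N).
    move=> s t; rewrite !inE /= => Ps Pt; rewrite !insubT => fst.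
    by have [] := finj _ _ (mem_set I) (mem_set I) fst.
  have [Pall|/existsNP[t /negP nPt]] := pselect (forall t, P t).
    by apply: uncountable_natbool; apply: sub_countable cP; apply: subset_card_le => t _; exact: Pall.
  have [|m [[nPm mle] _]] := Rwo [pred t | ~~ P t]; first by exists t.
  move/negP: nPm; apply; apply/asboolP.
  apply: (@sub_countable _ _ _ ([set t | P t] `|` [set m])).
    apply: subset_card_le => y /= Rym.
    have [Py|nPy] := boolP (P y); [by left|right].
    by apply: Ranti; rewrite Rym mle.
  rewrite -bigcup2E; apply: bigcup_countable => [|[|[|i]] _ /=].
    exact: countableP.
    exact: cP.
    exact: countable1.
    exact: countable0.
- move=> x; have /asboolP/countable_injP[f finj] := valP (x : W).
  apply/countable_injP; exists (fun y : Wo => f (val (y : W))).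
  move=> y z; rewrite !inE => /ltW yx /ltW zx fyz; apply: val_inj.
  by apply: finj fyz; rewrite inE.
Qed.

(** * The closed long ray *)

Definition co01 (R : realType) := {x : R | 0 <= x < 1}.

HB.instance Definition _ (R : realType) := SubChoice.on (co01 R).
HB.instance Definition _ (R : realType) :=
  [SubChoice_isSubOrder of co01 R by <: with ring_display].

Definition long_ray (R : realType) d (W : orderType d) : Type :=
  order_topology (W *l co01 R).

HB.instance Definition _ (R : realType) d (W : orderType d) :=
  OrderTopological.on (long_ray R W).

(** * Smooth 1-manifolds with boundary *)

Section smooth.
Variable R : realType.

Definition half_line : set R := `[0, +oo[.

Section charts.
Variable X : topologicalType.

(* A homeomorphism from an open subset of X onto a relatively open subset of
   the half-line [0, +oo[; the values of [cmap] outside [cdom], and of [cinv]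
   outside the image of [cmap], are irrelevant. *)
Record chart := Chart {
  cdom : set X;
  cmap : X -> R;
  cinv : R -> X;
  cdom_open : open cdom;
  cmap_open : exists2 O : set R, open O & cmap @` cdom = O `&` half_line;
  cmapK : {in cdom, cancel cmap cinv};
  cmap_continuous : {within cdom, continuous cmap};
  cinv_continuous : {within cmap @` cdom, continuous cinv} }.

Definition transition (c c' : chart) : R -> R := cmap c' \o cinv c.

(* Smoothness on a subset of R that need not be open: local existence of
   smooth extensions. *)
Definition smooth_on (A : set R) (f : R -> R) : Prop :=
  forall x, A x -> exists (O : set R) (g : R -> R),
    [/\ open O, O x, (forall n y, O y -> derivable (derive1n n g) y 1)
      & forall y, O y -> A y -> f y = g y].

Definition compatible (c c' : chart) : Prop :=
  smooth_on (cmap c @` (cdom c `&` cdom c')) (transition c c') /\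
  smooth_on (cmap c' @` (cdom c `&` cdom c')) (transition c' c).

(* A smooth structure is a maximal smooth atlas. *)
Record smooth_structure := SmoothStructure {
  atlas : set chart;
  atlas_cover : forall p, exists2 c, atlas c & cdom c p;
  atlas_compatible : forall c c', atlas c -> atlas c' -> compatible c c';
  atlas_maximal : forall c, (forall c', atlas c' -> compatible c c') ->
    atlas c }.

End charts.

(* The derivative relative to the half-line: one-sided at 0, and the usual one
   at positive points. *)
Definition half_derive (f : R -> R) (x : R) : R :=
  lim ((fun h => h^-1 * (f (x + h) - f x)) @
       within [set h | half_line (x + h)] 0^').

(** * The tangent bundle *)

Section tangent.
Variables (X : topologicalType) (A : smooth_structure X).

(* A tangent vector at p assigns to every chart around p a component, and
   components transform by the derivatives of the transition maps.  The
   components in the other charts are set to 0, so that equality of tangent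
   vectors is Leibniz equality. *)
Record tangent := Tangent {
  tbase : X;
  tcomp : chart X -> R;
  tcompE : forall c c', atlas A c -> atlas A c' ->
    cdom c tbase -> cdom c' tbase ->
    tcomp c' = half_derive (transition c c') (cmap c tbase) * tcomp c;
  tcomp0 : forall c, ~ (atlas A c /\ cdom c tbase) -> tcomp c = 0 }.

HB.instance Definition _ := gen_eqMixin tangent.
HB.instance Definition _ := gen_choiceMixin tangent.

(* The topology making, for every chart c, the set of vectors based in the
   domain U of c open and v |-> (c (base v), component of v in c) a
   homeomorphism from it onto c(U) x R. *)
Definition tangent_open (O : set tangent) : Prop :=
  forall c, atlas A c -> exists2 V : set (R * R), open V &
    forall v, cdom c (tbase v) -> O v <-> V (cmap c (tbase v), tcomp v c).

Lemma tangent_openT : tangent_open [set: tangent].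
Proof. by move=> c _; exists setT => //; exact: openT. Qed.

Lemma tangent_openI (O O' : set tangent) :
  tangent_open O -> tangent_open O' -> tangent_open (O `&` O').
Proof.
move=> oO oO' c Ac; have [V oV VE] := oO c Ac; have [V' oV' VE'] := oO' c Ac.
exists (V `&` V'); first exact: openI.
by move=> v cv; split => -[/(VE v cv) ? /(VE' v cv)].
Qed.

Lemma tangent_open_bigU (I : Type) (f : I -> set tangent) :
  (forall i, tangent_open (f i)) -> tangent_open (\bigcup_i f i).
Proof.
move=> of_ c Ac.
have /choice[V VE] : forall i, exists V : set (R * R), open V /\
    forall v, cdom c (tbase v) -> f i v <-> V (cmap c (tbase v), tcomp v c).
  by move=> i; have [V ? ?] := of_ i c Ac; exists V.
exists (\bigcup_i V i); first by apply: bigcup_open => i _; case: (VE i).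
move=> v cv; split => -[i _ /((VE i).2 v cv) ?]; by exists i.
Qed.

HB.instance Definition _ := @isOpenTopological.Build tangent
  tangent_open tangent_openT tangent_openI tangent_open_bigU.

Definition tscale (a : R) (v : tangent) : tangent.
Proof.
exists (tbase v) (fun c => a * tcomp v c).
- by move=> c c' Ac Ac' cv c'v; rewrite (tcompE Ac Ac' cv c'v) mulrCA.
- by move=> c cv; rewrite tcomp0 ?mulr0.
Defined.

End tangent.

(** * The surface M *)

Section surface.
Variables (d : Order.disp_t) (W : orderType d).
Local Notation L := (long_ray R W).
Variable A : smooth_structure L.

(* The vectors pointing in the increasing direction: in every chart, the
   component has the sign of the variation of the chart (nonzero, so that the
   vector is nonzero). *)
Definition tangent_pos : set (tangent A) := [set v |
  forall c, atlas A c -> cdom c (tbase v) -> \forall q \near tbase v,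
    (tbase v < q)%O -> 0 < tcomp v c * (cmap c q - cmap c (tbase v))].

Definition ray_origin (p : L) : Prop := forall q : L, (p <= q)%O.

Definition surface_rel (v w : tangent_pos) : bool :=
  `[< (exists i : int, val w = tscale (2 ^ i) (val v)) \/
      (ray_origin (tbase (val v)) /\ ray_origin (tbase (val w))) >].

Lemma tangent_eq (v w : tangent A) :
  tbase v = tbase w -> tcomp v =1 tcomp w -> v = w.
Proof.
case: v w => [p f H1 H2] [q g H3 H4] /= pq /funext fg; subst.
by congr Tangent; exact: Prop_irrelevance.
Qed.

Lemma tscale1 (v : tangent A) : tscale 1 v = v.
Proof. by apply: tangent_eq => //= c; rewrite mul1r. Qed.

Lemma tscaleA (a b : R) (v : tangent A) :
  tscale a (tscale b v) = tscale (a * b) v.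
Proof. by apply: tangent_eq => //= c; rewrite mulrA. Qed.

Lemma surface_rel_refl : reflexive surface_rel.
Proof. by move=> v; apply/asboolP; left; exists 0; rewrite expr0z tscale1. Qed.

Lemma surface_rel_impl v w : surface_rel v w -> surface_rel w v.
Proof.
move=> /asboolP[[i wv]|[? ?]]; apply/asboolP; last by right.
left; exists (- i); rewrite wv tscaleA -expfzDr ?pnatr_eq0//.
by rewrite addNr expr0z tscale1.
Qed.

Lemma surface_rel_sym : symmetric surface_rel.
Proof. by move=> v w; apply/idP/idP; exact: surface_rel_impl. Qed.

Lemma surface_rel_trans : transitive surface_rel.
Proof.
move=> w v u /asboolP[[i wv]|[v0 w0]] /asboolP[[j uw]|[w0' u0]]; apply/asboolP.
- by left; exists (j + i); rewrite uw wv tscaleA -expfzDr ?pnatr_eq0.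
- by right; split => //; move: w0'; rewrite wv.
- by right; split => //; rewrite uw.
- by right.
Qed.

Definition surface_equiv : equiv_rel tangent_pos :=
  EquivRel surface_rel surface_rel_refl surface_rel_sym surface_rel_trans.

Definition surface : Type := quotient_topology {eq_quot surface_equiv}.

End surface.

(** * Free homotopy classes *)

Section homotopy.
Variables X Y : topologicalType.

Definition homotopic (f g : X -> Y) : Prop := exists H : X * R -> Y,
  [/\ {within [set: X] `*` `[0, 1]%classic, continuous H},
      forall x, H (x, 0) = f x & forall x, H (x, 1) = g x].

Definition homotopy_classes : set (set (X -> Y)) :=
  [set C | exists2 f : X -> Y, continuous f &
     C = [set g | continuous g /\ homotopic f g]].

End homotopy.
End smooth.

Arguments homotopy_classes R X Y : clear implicits.

(* Main.v *)
Require Import Defs.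
From mathcomp Require Import all_boot all_order all_algebra.
From mathcomp Require Import all_classical all_reals all_analysis.
From mathcomp Require Import ring lra.

(**
Write L for the long ray and F : T^+ -> L for the composite of a continuous
map f : M -> L with the projection of T^+ onto M.

Homotopies: if two maps f, g : X -> L are bounded on the same subsets of X (in
the sense that a bound for one yields a bound for the other), the points c of L
that never lie strictly between f x and g x form a closed unbounded set C.
Cut along C, the interval between f x and g x lies in an initial segment of L
that is locally constant in x as long as f x <> g x; interpolating linearly in
a real parametrization of that segment gives a homotopy.

Rigidity: let H : X * [0, 1] -> L be continuous, X compact over initial
segments of L and H(x, 0) bounded.  Then H is bounded.  Otherwise, for b in L
and q rational, let E b q be the closed set of those y in L over which
H(., t) reaches b for some t <= q.  If b < b' are large enough, then for every q
either E b q is bounded or E b' q is unbounded; a countable intersection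
of closed unbounded sets being unbounded, some y lies in E b' 1 and satisfies
y \in E b q -> y \in E b' q for all q.  But the first time at which level b'
is reached over y is preceded by times at which level b is already exceeded.

Applied to H(v, t) = F(2^t v) on {F <= c}, rigidity shows that an unbounded
f tends to infinity along M, so that f is comparable to the projection of M to
L; applied to a homotopy, it shows that boundedness is homotopy invariant. The
two classes are therefore the bounded and the unbounded maps.
*)

Set Implicit Arguments.
Unset Strict Implicit.
Unset Printing Implicit Defensive.
Import Order.TTheory GRing.Theory Num.Theory.
Import numFieldNormedType.Exports.
Local Open Scope classical_set_scope.
Local Open Scope ring_scope.

(** * Order topologies resembling the long ray *)

(* All that the argument uses of the long ray; [ray_embed] says that its initial
   segments embed into the real line. *)
Record ray_like (R : realType) d (L : orderTopologicalType d) : Prop := {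
  ray_inhabited : exists x : L, True;
  ray_dense : forall x y : L, (x < y)%O -> exists2 z, (x < z)%O & (z < y)%O;
  ray_seq_bounded : forall u : nat -> L, exists b, forall n, (u n < b)%O;
  ray_inf : forall S : set L, S !=set0 -> exists2 m, (forall x, S x -> (m <= x)%O)
    & (forall z, (forall x, S x -> (z <= x)%O) -> (z <= m)%O);
  ray_embed : forall a : L, exists e : L -> R, [/\ continuous e,
    {homo e : x y / (x <= y)%O >-> x <= y} &
    forall x y, (x < y)%O -> (y <= a)%O -> e x < e y] }.

Section ray_theory.
Variables (R : realType) (d : Order.disp_t) (L : orderTopologicalType d).
Hypothesis hL : ray_like R L.
Local Open Scope order_scope.

Lemma ray_nomax (x : L) : exists y, x < y.
Proof. by have [v /(_ 0%N)] := ray_seq_bounded hL (fun=> x); exists v. Qed.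

Lemma ray_sup (S : set L) b : (forall x, S x -> x <= b) ->
  exists2 m, (forall x, S x -> x <= m) & (forall z, (forall x, S x -> x <= z) -> m <= z).
Proof.
move=> Sb; have [|m mlb mglb] := ray_inf hL (S := [set z | forall x, S x -> x <= z]).
  by exists b.
exists m; last by move=> z Sz; apply: mlb.
by move=> x Sx; apply: mglb => z; apply.
Qed.

Lemma ray_min : exists o : L, forall x, o <= x.
Proof.
have [x _] := ray_inhabited hL.
have [|m mle _] := ray_inf hL (S := setT); first by exists x.
by exists m => y; apply: mle.
Qed.

(** The two sides of [x] are treated apart. The left alternative without [a] serves the least
    element; on the right, [ray_nomax] always supplies a [b]. *)
Lemma nbhs_rayP (x : L) (O : set L) : nbhs x O ->
  ((exists2 a, a < x & forall z, a < z -> z <= x -> O z) \/ (forall z, z <= x -> O z)) /\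
  exists2 b, x < b & forall z, x <= z -> z < b -> O z.
Proof.
rewrite itv_nbhsE => -[[l r] [lr xlr] sub].
have {sub} sub z : z \in Interval l r -> O z by move=> ?; apply: sub.
split.
  case: l lr xlr sub => [[] a|[]]; case: r => [[] b|[]] //; rewrite ?in_itv /= ?andbT => _ xlr sub.
  - left; have/andP[ax xb] := xlr; exists a => // z az zx; apply: sub; rewrite in_itv /= az /=.
    exact: le_lt_trans xb.
  - left; exists a => // z az zx; apply: sub; by rewrite in_itv /= az.
  - right => z zx; apply: sub; rewrite in_itv /=; exact: le_lt_trans xlr.
  - by right => z zx; apply: sub.
have [y xy] := ray_nomax x.
case: l lr xlr sub => [[] a|[]]; case: r => [[] b|[]] //; rewrite ?in_itv /= ?andbT => _ xlr sub.
- have/andP[ax xb] := xlr; exists b => // z xz zb; apply: sub; rewrite in_itv /= zb andbT.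
  exact: lt_le_trans xz.
- exists y => // z xz zy; apply: sub; rewrite in_itv /= andbT; exact: lt_le_trans xz.
- by exists b => // z xz zb; apply: sub; rewrite in_itv.
- by exists y => // z xz zy; apply: sub.
Qed.

Lemma open_ray_gt (a : L) : open [set z : L | a < z].
Proof. by rewrite -set_itvoy; exact: rray_open. Qed.

Lemma open_ray_lt (a : L) : open [set z : L | z < a].
Proof. by rewrite -set_itvNyo; exact: lray_open. Qed.

Lemma near_ray_gt (a x : L) : a < x -> \forall z \near x, a < z.
Proof. by move=> ax; apply: (open_nbhs_nbhs (conj (open_ray_gt a) ax)). Qed.

Lemma near_ray_lt (a x : L) : x < a -> \forall z \near x, z < a.
Proof. by move=> ax; apply: (open_nbhs_nbhs (conj (open_ray_lt a) ax)). Qed.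

Lemma near_continuous_gt (X : topologicalType) (f : X -> L) (a : L) (x : X) :
  continuous f -> a < f x -> \forall y \near x, a < f y.
Proof. by move=> cf ax; exact: (cf x _ (near_ray_gt ax)). Qed.

Lemma near_continuous_lt (X : topologicalType) (f : X -> L) (a : L) (x : X) :
  continuous f -> f x < a -> \forall y \near x, f y < a.
Proof. by move=> cf ax; exact: (cf x _ (near_ray_lt ax)). Qed.

Lemma closed_ray_le (a : L) : closed [set z : L | z <= a].
Proof. by rewrite -set_itvNyc; exact: lray_closed. Qed.

Lemma closed_ray_ge (a : L) : closed [set z : L | a <= z].
Proof. by rewrite -set_itvcy; exact: rray_closed. Qed.

Lemma cvg_rayP (T : Type) (F : set_system T) (f : T -> L) (x : L) : Filter F ->
  (forall a, a < x -> \forall t \near F, a < f t) ->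
  (forall b, x < b -> \forall t \near F, f t < b) -> f @ F --> x.
Proof.
move=> FF Fa Fb U /nbhs_rayP[Ul [b xb Ub]].
have fb := Fb b xb.
case: Ul => [[a ax Ua]|Ul].
  have fa := Fa a ax; apply: filterS2 fa fb => t at_ tb /=.
  by have [zx|/ltW xz] := leP (f t) x; [apply: Ua|apply: Ub].
apply: filterS fb => t tb /=.
by have [zx|/ltW xz] := leP (f t) x; [apply: Ul|apply: Ub].
Qed.

Lemma within_continuous_rayP (T : topologicalType) (D : set T) (h : T -> L) :
  (forall p, D p -> forall a, a < h p -> \forall q \near p, D q -> a < h q) ->
  (forall p, D p -> forall b, h p < b -> \forall q \near p, D q -> h q < b) ->
  {within D, continuous h}.
Proof.
move=> lo hi; apply/subspace_continuousP => p Dp.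
by apply: cvg_rayP => b hb; [exact: lo|exact: hi].
Qed.

(** Each neighbourhood of [s] reaches down past some [u n], hence contains the point of [C] between
    [u n] and [s]. *)
Lemma ray_closed_sup (C : set L) (u : nat -> L) s : closed C ->
  (forall n, u n <= s) -> (forall z, (forall n, u n <= z) -> s <= z) ->
  (forall n, exists2 c, C c & u n <= c <= s) -> C s.
Proof.
move=> cC us sl uC; rewrite (closure_id C).1// => U /nbhs_rayP[Ul _].
have [c0 Cc0 /andP[_ c0s]] := uC 0%N.
case: Ul => [[a as_ Ua]|Ul]; last by exists c0; split => //; apply: Ul.
have [n aun] : exists n, a < u n.
  apply: contrapT => /forallNP H; move: as_; rewrite ltNge => /negP; apply.
  by apply: sl => n; rewrite leNgt; apply/negP.
have [c Cc /andP[unc cs]] := uC n.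
by exists c; split => //; apply: Ua => //; exact: lt_le_trans unc.
Qed.

Definition ray_unbounded (C : set L) := forall a, exists2 c, C c & a < c.

(** The closing-off device: increasing iterates are bounded because the ray has uncountable
    cofinality, and their supremum [s] inherits what each step secures. *)
Lemma ray_iter_sup (f : nat -> L -> L) (a : L) : (forall n x, x < f n x) ->
  exists u : nat -> L, exists s, [/\ u 0%N = a, (forall n, u n.+1 = f n (u n)),
    (forall n, u n < s) & (forall z, (forall n, u n <= z) -> s <= z)].
Proof.
move=> xf; pose u := fix u n := if n is m.+1 then f m (u m) else a.
have [b ub] := ray_seq_bounded hL u.
have [|s us sl] := @ray_sup (range u) b; first by move=> _ [n _ <-]; exact: ltW.
exists u, s; split => //.
- move=> n; apply: (lt_le_trans (y := u n.+1)); first exact: xf.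
  by apply: us; exists n.+1.
- by move=> z uz; apply: sl => _ [n _ <-].
Qed.

(** One step [h] jumps beyond a chosen point of every [C n]; the supremum of the iterates of [h] is
    then a limit of points of each [C n]. *)
Lemma ray_club_bigcap (C : nat -> set L) :
  (forall n, closed (C n)) -> (forall n, ray_unbounded (C n)) ->
  ray_unbounded (\bigcap_n C n).
Proof.
move=> cC uC a.
have /choice[g gP] : forall nx : nat * L, exists y, C nx.1 y /\ nx.2 < y.
  by move=> [n x]; have [y ? ?] := uC n x; exists y.
have /choice[h hP] : forall x : L, exists y, forall n, g (n, x) < y.
  by move=> x; exact: ray_seq_bounded hL _.
have xh x : x < h x.
  by apply: lt_trans (hP x 0%N); exact: (gP (0%N, x)).2.
have [u [s [u0 uS us sl]]] := @ray_iter_sup (fun=> h) a (fun=> xh).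
exists s; last by rewrite -u0.
move=> n _; apply: (@ray_closed_sup _ u) => //; first by move=> m; exact: ltW.
move=> m; have [/= Cg ug] := gP (n, u m); exists (g (n, u m)) => //.
by rewrite (ltW ug) ltW// (lt_trans (hP _ n))// -(uS m).
Qed.

(* Real parametrization of segments of the ray *)
Local Close Scope order_scope.

(** The supremum [m] of the points up to [y] with value at most [r] works: a value below [r] at [m]
    would persist to the right, a value above [r] to the left. *)
Lemma ray_ivt (e : L -> R) (x y : L) (r : R) : continuous e -> (x <= y)%O ->
  e x <= r <= e y -> exists2 z, (x <= z <= y)%O & e z = r.
Proof.
move=> ce xy /andP[xr ry].
have [|m mS ml] := @ray_sup [set z | (z <= y)%O /\ e z <= r] y; first by move=> z [].
have xm : (x <= m)%O by apply: mS.
have my : (m <= y)%O by apply: ml => z [].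
exists m; first by rewrite xm.
have [emr|emr|//] := ltgtP (e m) r.
  have m_y : (m < y)%O by rewrite lt_neqAle my andbT; apply: contraTneq ry => <-; rewrite -ltNge.
  have /nbhs_rayP[_ [b mb Ob]] : nbhs m [set z | e z < r].
    exact: (cvgr_lt _ (ce m)).
  have [|z mz zb] := ray_dense hL (x := m) (y := Order.min b y); first by rewrite lt_min mb m_y.
  have [zb' zy] : (z < b)%O /\ (z < y)%O by apply/andP; rewrite -lt_min.
  have := mS z (conj (ltW zy) (ltW (Ob _ (ltW mz) zb'))); by rewrite leNgt mz.
have /nbhs_rayP[[[c cm Oc]|Oc] _] : nbhs m [set z | r < e z].
  exact: (cvgr_gt _ (ce m)).
  have : (m <= c)%O.
    apply: ml => z [zy ezr]; rewrite leNgt; apply/negP => cz.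
    by have := Oc z cz (mS z (conj zy ezr)); rewrite /= ltNge ezr.
  by rewrite leNgt cm.
by have := Oc x xm; rewrite /= ltNge xr.
Qed.

(** [k] inverts the embedding [e] on the segment. Since [e] is monotone, it reflects strict
    inequalities, which gives the continuity of [k]. *)
Lemma ray_param (a b : L) : (a <= b)%O -> exists (u v : R) (k : R -> L),
  [/\ {within `[u, v]%classic, continuous k},
    forall s, u <= s <= v -> (a <= k s <= b)%O,
    forall s t, u <= s -> s < t -> t <= v -> (k s < k t)%O &
    forall z, (a <= z <= b)%O -> exists2 s, u <= s <= v & k s = z].
Proof.
move=> ab; have [e [ce emono einc]] := ray_embed hL b.
have e_lt x y : e x < e y -> (x < y)%O by rewrite ltNge; apply: contraNlt => /emono.
have /choice[k kP] : forall r, exists z, e a <= r <= e b -> (a <= z <= b)%O /\ e z = r.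
  move=> r; have [/(ray_ivt ce ab)[z zab <-]|N] := pselect (e a <= r <= e b).
    by exists z.
  by exists a.
exists (e a), (e b), k; split.
- suff H (r : R) : e a <= r <= e b ->
      (forall c, (c < k r)%O -> \forall t \near r, e a <= t <= e b -> (c < k t)%O) /\
      (forall c, (k r < c)%O -> \forall t \near r, e a <= t <= e b -> (k t < c)%O).
    by apply: within_continuous_rayP => r; rewrite /= in_itv /= => /H[h1 h2] c hc;
      [have := h1 c hc|have := h2 c hc]; apply: filterS => t; rewrite /= in_itv.
  move=> rI; split=> c.
    have [/andP[_ kb] kr] := kP r rI => ck; have ec : e c < r by rewrite -kr; exact: einc.
    have : \forall t \near r, e c < t by apply: open_nbhs_nbhs; split; [exact: (@open_gt R (e c))|].
    apply: filterS => t ect tI.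
    by apply: e_lt; rewrite (kP t tI).2.
  have [_ kr] := kP r rI => kc.
  (* Past [b] the map [e] need not be strictly increasing, but there the values of [k] already lie
     below [c]. *)
  have [cb|bc] := leP c b; last first.
    have kc' t : e a <= t <= e b -> (k t < c)%O by move=> /kP[/andP[_ kb] _]; exact: le_lt_trans bc.
    by apply: filterS filterT => t _; exact: kc'.
  have ec : r < e c by rewrite -kr; exact: einc.
  have : \forall t \near r, t < e c by apply: open_nbhs_nbhs; split; [exact: (@open_lt R (e c))|].
  apply: filterS => t ect tI.
  by apply: e_lt; rewrite (kP t tI).2.
- by move=> s /kP[].
- move=> s t us st tv; apply: e_lt.
  rewrite (kP s _).2 ?us ?(le_trans (ltW st) tv)//.
  by rewrite (kP t _).2 ?tv ?(le_trans us (ltW st)).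
- move=> z /andP[az zb]; have ez : e a <= e z <= e b by rewrite !emono.
  exists (e z) => //; have [/andP[_ kb] ek] := kP _ ez.
  by case: (ltgtP (k (e z)) z) => // kz; [have := einc _ _ kz zb|have := einc _ _ kz kb]; rewrite ek ltxx.
Qed.

Lemma ray_segment_compact (a b : L) : compact [set z : L | (a <= z <= b)%O].
Proof.
have [ab|ba] := leP a b; last first.
  have -> : [set z : L | (a <= z <= b)%O] = set0; last exact: compact0.
  by rewrite -subset0 => z /= /andP[/le_trans h /h]; rewrite leNgt ba.
have [u [v [k [ck kab _ kS]]]] := ray_param ab.
have -> : [set z : L | (a <= z <= b)%O] = k @` `[u, v]%classic.
  apply/seteqP; split => [z /kS[s suv <-]|_ [s suv <-]].
    by exists s => //=; rewrite in_itv.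
  by apply: kab; move: suv; rewrite /= in_itv.
by apply: continuous_compact => //; exact: segment_compact.
Qed.

(** Only [a <= p] can be asked for, as [p] may be the least element, in which case [a] is [p]
    itself. *)
Lemma nbhs_ray_segment (p : L) (U : set L) : nbhs p U -> exists a b,
  [/\ (a <= p)%O, (p < b)%O, (forall z, (a <= z <= b)%O -> U z) &
     \forall z \near p, (a <= z <= b)%O].
Proof.
move=> /nbhs_rayP[Ul [b pb Ub]].
have [b' pb' b'b] := ray_dense hL pb.
have nb := near_ray_lt pb'.
have bU z : (p <= z)%O -> (z <= b')%O -> U z.
  by move=> pz zb'; apply: Ub => //; exact: le_lt_trans b'b.
case: Ul => [[a ap Ua]|Ul].
  have [a' aa' a'p] := ray_dense hL ap.
  exists a', b'; split => //; first exact: ltW.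
    move=> z /andP[az zb]; have [zp|/ltW pz] := leP z p; last exact: bU.
    by apply: Ua => //; exact: lt_le_trans az.
  by apply: filterS2 (near_ray_gt a'p) nb => z /ltW -> /ltW ->.
have [x0 x0min] := ray_min.
exists x0, b'; split => //.
  by move=> z /andP[_ zb]; have [zp|/ltW pz] := leP z p; [exact: Ul|exact: bU].
by apply: filterS nb => z /ltW ->; rewrite x0min.
Qed.

Lemma nondecreasing_ray_continuous (g : L -> R) :
  {homo g : x y / (x <= y)%O >-> x <= y} ->
  (forall x e, 0 < e -> (forall z, g x - e < g z) \/
     (exists2 y, (y < x)%O & g x - e < g y)) ->
  (forall x e, 0 < e -> (forall z, g z < g x + e) \/
     (exists2 y, (x < y)%O & g y < g x + e)) ->
  continuous g.
Proof.
move=> mg gl gr x; apply/cvgrPdist_lt => e e0.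
have lo : \forall z \near x, g x - e < g z.
  have [xe|[y /near_ray_gt yx xe]] := gl x e e0; first exact: nearW.
  by apply: filterS yx => z /ltW /mg; exact: lt_le_trans.
have hi : \forall z \near x, g z < g x + e.
  have [xe|[y /near_ray_lt yx xe]] := gr x e e0; first exact: nearW.
  by apply: filterS yx => z /ltW /mg /le_lt_trans; exact.
by apply: filterS2 lo hi => z zl zr; rewrite ltr_norml; apply/andP; split; lra.
Qed.
End ray_theory.

(** * Series of functions with geometric weights *)

Section weighted_sum.
Variables (R : realType) (X : topologicalType) (G : nat -> X -> R).
Hypothesis G01 : forall k x, 0 <= G k x <= 1.

Let s (n : nat) (x : X) : R := \sum_(k < n) 2^-1 ^+ k.+1 * G k x.

Definition weighted_sum (x : X) : R := limn (fun n => s n x).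

Let sS n x : s n.+1 x = s n x + 2^-1 ^+ n.+1 * G n x.
Proof. by rewrite /s big_ord_recr. Qed.

Let half_gt0 n : 0 < 2^-1 ^+ n :> R.
Proof. by rewrite exprn_gt0// invr_gt0 ltr0n. Qed.

(** The weights of index [N] to [N + n - 1] add up to exactly the difference of powers on the
    right. *)
Let s_bounds N n x : s N x <= s (N + n) x <= s N x + 2^-1 ^+ N - 2^-1 ^+ (N + n).
Proof.
elim: n => [|n /andP[h1 h2]]; first by rewrite addn0 addrK lexx.
rewrite addnS sS; have := half_gt0 (N + n).+1; have /andP[g0 g1] := G01 (N + n) x.
move=> p; have q0 : 0 <= 2^-1 ^+ (N + n).+1 * G (N + n) x by rewrite mulr_ge0// ltW.
have q1 : 2^-1 ^+ (N + n).+1 * G (N + n) x <= 2^-1 ^+ (N + n).+1 by rewrite ger_pMr.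
have e : 2^-1 ^+ (N + n) = 2 * 2^-1 ^+ (N + n).+1 :> R by rewrite exprS mulrA mulfV// mul1r.
by rewrite e in h2; apply/andP; split; lra.
Qed.

Let s_cvg x : cvgn (fun n => s n x).
Proof.
apply: nondecreasing_is_cvgn.
  by move=> m n mn; rewrite -(subnKC mn); case/andP: (s_bounds m (n - m) x).
exists 1 => _ [n _ <-]; have := s_bounds 0 n x; rewrite add0n /s big_ord0 add0r expr0.
by move=> /andP[_ /le_trans]; apply; rewrite gerBl ltW.
Qed.

Let sum_bounds N x : s N x <= weighted_sum x <= s N x + 2^-1 ^+ N.
Proof.
apply/andP; split.
  apply: limr_ge; first exact: s_cvg.
  exists N => // n /= Nn; rewrite -(subnKC Nn); by case/andP: (s_bounds N (n - N) x).
apply: limr_le; first exact: s_cvg.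
exists N => // n /= Nn; rewrite -(subnKC Nn); case/andP: (s_bounds N (n - N) x) => _ /le_trans.
by apply; rewrite gerBl ltW.
Qed.

Lemma le_weighted_sum x y : (forall k, G k x <= G k y) -> weighted_sum x <= weighted_sum y.
Proof.
move=> xy; apply: ler_lim; [exact: s_cvg|exact: s_cvg|].
apply: nearW => n; apply: ler_sum => k _.
by apply: ler_wpM2l; [exact/ltW/half_gt0|exact: xy].
Qed.

(** The gap [c] contributed by the term of index [k] is present in all later partial sums and so
    survives the limit. *)
Lemma lt_weighted_sum x y k : (forall k, G k x <= G k y) -> G k x < G k y ->
  weighted_sum x < weighted_sum y.
Proof.
move=> xy xyk; pose c := 2^-1 ^+ k.+1 * (G k y - G k x).
have c0 : 0 < c by rewrite mulr_gt0// subr_gt0.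
suff : weighted_sum x + c <= weighted_sum y by apply: lt_le_trans; rewrite ltrDl.
have -> : weighted_sum x + c = limn (fun n => s n x + c).
  by apply/esym/cvg_lim => //; apply: cvgD; [exact: s_cvg|exact: cvg_cst].
apply: ler_lim; [|exact: s_cvg|].
  by apply: is_cvgD; [exact: s_cvg|exact: is_cvg_cst].
exists k.+1 => // n /= kn; rewrite /s (bigD1 (Ordinal kn))//= [leRHS](bigD1 (Ordinal kn))//=.
rewrite addrAC lerD//; first by rewrite /c mulrBr addrC subrK.
by apply: ler_sum => j _; apply: ler_wpM2l; [exact/ltW/half_gt0|exact: xy].
Qed.

(** The partial sums are continuous and converge uniformly, with error at most 2^-N. *)
Lemma weighted_sum_continuous : (forall k, continuous (G k)) -> continuous weighted_sum.
Proof.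
move=> cG x; apply/cvgrPdist_lt => e e0.
have [N Ne] : exists N, 2^-1 ^+ N < e / 2.
  have [N _ /(_ N (leqnn N))] := near_infty_natSinv_expn_lt (PosNum (divr_gt0 e0 (ltr0n R 2))).
  by rewrite /= div1r -exprVn => h; exists N.
have cs : continuous (s N).
  elim: N {Ne} => [|n IHn] y.
    have -> : s 0 = cst 0 by apply/funext => z; rewrite /s big_ord0.
    exact: cvg_cst.
  have -> : s n.+1 = fun z => s n z + 2^-1 ^+ n.+1 * G n z by apply/funext => z; exact: sS.
  by apply: cvgD; [exact: IHn|apply: cvgM; [exact: cvg_cst|exact: cG]].
have := cs x; move/cvgrPdist_lt => /(_ (e / 2)).
rewrite divr_gt0// => /(_ isT); apply: filterS => y.
have := sum_bounds N x; have := sum_bounds N y.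
move=> /andP[? ?] /andP[? ?]; rewrite !ltr_norml => /andP[? ?]; apply/andP; split; lra.
Qed.
End weighted_sum.

(** * The long ray satisfies [ray_like] *)

Section long_ray_order.
Variables (R : realType) (d : Order.disp_t) (W : orderType d).
Hypothesis hW : is_omega1 W.
Local Notation L := (long_ray R W).
Local Open Scope order_scope.

Definition ray_pt (w : W) (t : co01 R) : L := (w, t).

Lemma le_rayE (x y : L) :
  (x <= y) = (x.1 < y.1) || ((x.1 == y.1) && (val x.2 <= val y.2)%R).
Proof.
transitivity ((x.1 <= y.1) && ((x.1 >= y.1) ==> (x.2 <= y.2))).
  by case: x y => [a s] [b r]; exact: lexi_pair.
by rewrite leEsub; case: ltgtP.
Qed.

Lemma lt_rayE (x y : L) :
  (x < y) = (x.1 < y.1) || ((x.1 == y.1) && (val x.2 < val y.2)%R).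
Proof.
rewrite [x < y]ltNge le_rayE negb_or negb_and [y.1 == _]eq_sym.
by case: ltgtP => //= _; rewrite real_ltNge ?num_real.
Qed.

Definition co01_mk (t : R) (t01 : (0 <= t < 1)%R) : co01 R := exist _ t t01.

Lemma co010_subproof : (0 <= (0 : R) < 1)%R.
Proof. by rewrite lexx ltr01. Qed.
Definition co010 : co01 R := co01_mk co010_subproof.

Lemma omega1_min (S : set W) : S !=set0 -> exists2 w, S w & forall v, S v -> w <= v.
Proof.
move=> [x Sx]; have [m [[mA mle] _]] := omega1_wo hW (A := fun w => `[< S w >]) (ex_intro _ x (asboolT Sx)).
exists m; first exact/asboolP.
by move=> v Sv; apply: mle; apply/asboolP.
Qed.

(** Otherwise [W] would be a countable union of countable initial segments. *)
Lemma omega1_seq_bounded (u : nat -> W) : exists w, forall n, u n < w.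
Proof.
apply: contrapT => /forallNP H; apply: (omega1_uncountable hW).
apply: (@sub_countable _ _ _ (\bigcup_n ([set y | y < u n] `|` [set u n])%classic)).
  apply: subset_card_le => w _; have [n /negP] := (existsNP _).2 (H w).
  rewrite -leNgt le_eqVlt => /orP[/eqP ->|wu]; exists n => //; [by right|by left].
apply: bigcup_countable => // n _; rewrite -bigcup2E.
by apply: bigcup_countable => [|[|[|i]] _ /=];
  [exact: countableP|exact: omega1_segment|exact: countable1|exact: countable0].
Qed.

Lemma omega1_nomax (w : W) : exists v, w < v.
Proof. by have [v /(_ 0%N)] := omega1_seq_bounded (fun=> w); exists v. Qed.

Lemma long_ray_seq_bounded (u : nat -> L) : exists b, forall n, u n < b.
Proof.
have [w uw] := omega1_seq_bounded (fun n => (u n).1).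
by exists (ray_pt w co010) => n; rewrite lt_rayE uw.
Qed.

(** The infimum has the least first coordinate [w] occurring in [S], and the real infimum of the
    second coordinates above [w]; the latter stays below 1 because it is bounded by that of a point
    of [S]. *)
Lemma long_ray_inf (S : set L) : S !=set0 ->
  exists2 m, (forall x, S x -> m <= x) & (forall z, (forall x, S x -> z <= x) -> z <= m).
Proof.
move=> [x0 Sx0].
have [|w [x1 Sx1 x1w] wmin] := @omega1_min [set x.1 | x in S]; first by exists x0.1, x0.
pose T := [set val x.2 | x in [set x | S x /\ x.1 = w]].
have T0 : T !=set0 by exists (val x1.2), x1.
have Tb : lbound T 0%R by move=> _ [x _ <-]; have /andP[] := valP x.2.
have Ti : has_inf T by split => //; exists 0%R.
have inf01 : (0 <= inf T < 1)%R.
  rewrite lb_le_inf//=; apply: (le_lt_trans (y := val x1.2)).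
    by apply: ge_inf; [exists 0%R|exists x1].
  by have /andP[] := valP x1.2.
exists (ray_pt w (co01_mk inf01)).
  move=> x Sx; rewrite le_rayE /=.
  have := wmin _ (imageP _ Sx); rewrite le_eqVlt => /orP[/eqP wx|->//].
  apply/orP; right; rewrite wx eqxx /=; apply: ge_inf; first by exists 0%R.
  by exists x.
move=> z zlb; rewrite le_rayE /=.
have := zlb _ Sx1; rewrite le_rayE x1w => /orP[->//|/andP[/eqP zw _]].
apply/orP; right; rewrite zw eqxx /=; apply: lb_le_inf => // _ [x [Sx xw] <-].
by have := zlb _ Sx; rewrite le_rayE xw zw ltxx eqxx.
Qed.

Lemma long_ray_dense (x y : L) : x < y -> exists2 z, x < z & z < y.
Proof.
rewrite lt_rayE; case: x y => [a s] [b r] /= /orP[ab|/andP[/eqP <- sr]].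
  have /andP[s0 s1] := valP s.
  have m01 : (0 <= (val s + 1) / 2 < 1)%R.
    by rewrite divr_ge0 ?addr_ge0//= ltr_pdivrMr// mul1r ltrD2r.
  exists (ray_pt a (co01_mk m01)); rewrite lt_rayE /= ?ab// eqxx ltxx /=.
  by rewrite ltr_pdivlMr// mulr_natr mulr2n ltrD2l.
have /andP[s0 s1] := valP s; have /andP[r0 r1] := valP r.
have [sm mr] := midf_lt sr.
have m01 : (0 <= (val s + val r) / 2 < 1)%R.
  by rewrite (le_trans s0 (ltW sm)) (lt_trans mr r1).
by exists (ray_pt a (co01_mk m01)); rewrite lt_rayE /= eqxx ltxx.
Qed.

Local Close Scope order_scope.

(* Climbs from 0 to 1 along the copy of [0, 1[ above v and is constant elsewhere, so that
   a positive combination of the blocks of all v <= w is strictly increasing up to w. *)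
Definition block (v : W) (x : L) : R :=
  if (x.1 < v)%O then 0 else if x.1 == v then val x.2 else 1.

Lemma block01 v x : 0 <= block v x <= 1.
Proof.
rewrite /block; case: ifP => _; first by rewrite lexx ler01.
case: ifP => _; last by rewrite lexx ler01.
by have /andP[-> /ltW] := valP x.2.
Qed.

Lemma le_block v x y : (x <= y)%O -> block v x <= block v y.
Proof.
rewrite le_rayE => /orP[xy|/andP[/eqP xy xy2]]; last first.
  by rewrite /block xy; case: ifP => // _; case: ifP.
have /andP[x0 /ltW x1] := valP x.2; have /andP[y0 y1] := valP y.2.
rewrite /block; case: (ltgtP x.1 v) => xv; case: (ltgtP y.1 v) => yv //.
- by have := lt_trans (lt_trans xv xy) yv; rewrite ltxx.
- by have := lt_trans xv xy; rewrite yv ltxx.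
- by have := lt_trans yv (le_lt_trans _ xy); rewrite xv ltxx => /(_ (lexx _)).
- by move: xy; rewrite xv yv ltxx.
Qed.

Lemma block_continuous v : continuous (block v).
Proof.
apply: nondecreasing_ray_continuous => [|x e e0|x e e0]; first exact: le_block.
  have [xe|xe] := ltP (block v x - e) 0.
    by left => z; apply: lt_le_trans xe _; case/andP: (block01 v z).
  right; have /andP[x0 x1] := block01 v x.
  (* The witness is taken in the copy of [0, 1[ above [v], where [block v] is the second
     coordinate. *)
  have m01 : 0 <= block v x - e / 2 < 1 by apply/andP; split; lra.
  exists (ray_pt v (co01_mk m01)); last by rewrite {2}/block /= ltxx eqxx; lra.
  by rewrite lt_rayE /=; move: xe; rewrite /block; case: ltgtP => //= _; lra.
have [xe|xe] := ltP 1 (block v x + e).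
  by left => z; apply: le_lt_trans xe; case/andP: (block01 v z).
right; have /andP[x0 x1] := block01 v x.
have m01 : 0 <= block v x + e / 2 < 1 by apply/andP; split; lra.
exists (ray_pt v (co01_mk m01)); last by rewrite {1}/block /= ltxx eqxx; lra.
by rewrite lt_rayE /=; move: xe; rewrite /block; case: ltgtP => //= _; lra.
Qed.

(** Only countably many [v] lie below [a.1], so their blocks can be summed with geometric weights,
    numbered by an injection [f]; numbers outside its range get the zero function. Strictness at
    [x < y] comes from the block of [x.1]. *)
Lemma long_embed (a : L) : exists e : L -> R, [/\ continuous e,
  {homo e : x y / (x <= y)%O >-> x <= y} &
  forall x y, (x < y)%O -> (y <= a)%O -> e x < e y].
Proof.
have cW : countable [set v : W | (v <= a.1)%O].
  have [b ab] := omega1_nomax a.1.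
  apply: sub_countable (omega1_segment hW b); apply: subset_card_le => v /= /le_lt_trans; exact.
have /countable_injP[f finj] := cW.
have /choice[G GP] : forall k, exists g : L -> R,
    (exists2 v, (v <= a.1)%O /\ f v = k & g = block v) \/
    (~ (exists2 v, (v <= a.1)%O & f v = k) /\ g = cst 0).
  move=> k; have [[v va fv]|N] := pselect (exists2 v, (v <= a.1)%O & f v = k).
    by exists (block v); left; exists v.
  by exists (cst 0); right.
have G01 k x : 0 <= G k x <= 1.
  by case: (GP k) => [[v _ ->]|[_ ->]]; [exact: block01|rewrite lexx ler01].
have cG k : continuous (G k).
  by case: (GP k) => [[v _ ->]|[_ ->]]; [exact: block_continuous|exact: cst_continuous].
have leG x y : (x <= y)%O -> forall k, G k x <= G k y.
  by move=> xy k; case: (GP k) => [[v _ ->]|[_ ->]] //; exact: le_block.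
have Gf v : (v <= a.1)%O -> G (f v) = block v.
  move=> va; case: (GP (f v)) => [[u [ua fu] ->]|[[]]]; last by exists v.
  by congr block; apply: finj => //; rewrite inE.
exists (weighted_sum G); split.
- exact: weighted_sum_continuous.
- by move=> x y xy; apply: le_weighted_sum => //; exact: leG.
move=> x y xy ya; apply: (@lt_weighted_sum _ _ _ _ _ _ (f x.1)) => //; first exact/leG/ltW.
have xa : (x.1 <= a.1)%O.
  have := lt_le_trans xy ya; rewrite lt_rayE => /orP[/ltW//|/andP[/eqP -> _]//].
rewrite Gf// /block ltxx eqxx; have /andP[_ x1] := valP x.2.
move: xy; rewrite lt_rayE => /orP[xy|/andP[/eqP -> xy]]; last by rewrite ltxx eqxx.
by rewrite ltNge (ltW xy) /= gt_eqF.
Qed.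

Lemma long_ray_like : ray_like R L.
Proof.
split; [|exact: long_ray_dense|exact: long_ray_seq_bounded|exact: long_ray_inf|exact: long_embed].
apply: contrapT => N0; apply: (omega1_uncountable hW).
apply: (@sub_countable _ _ _ set0); last exact: countable0.
by apply: subset_card_le => w _; apply: N0; exists (ray_pt w co010).
Qed.
End long_ray_order.

(** * Homotopies between maps into the ray *)

Section coarse_homotopy.
Variables (R : realType) (d : Order.disp_t) (L : orderTopologicalType d).
Hypothesis hL : ray_like R L.
Variables (X : topologicalType) (f g : X -> L).
Hypotheses (cf : continuous f) (cg : continuous g).
Hypothesis fg_coarse : forall c, exists b, forall x,
  ((f x <= c)%O -> (g x <= b)%O) /\ ((g x <= c)%O -> (f x <= b)%O).

Let separated (c : L) (x : X) :=
  ((f x < c)%O /\ (c < g x)%O) \/ ((g x < c)%O /\ (c < f x)%O).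

Let C : set L := [set c | forall x, ~ separated c x].

(** [h] bounds each map where the other is at most a given level. At the supremum [s] of its
    iterates, a value of one map below [s] is below some [u n], so the other value is below
    [u n.+1], hence below [s]. *)
Let C_unbounded : ray_unbounded C.
Proof.
move=> a.
have /choice[h hP] : forall c, exists b, (c < b)%O /\ forall x,
    ((f x <= c)%O -> (g x < b)%O) /\ ((g x <= c)%O -> (f x < b)%O).
  move=> c; have [b bP] := fg_coarse c.
  have [b' bb'] := ray_nomax hL (Order.max b c).
  move: bb'; rewrite gt_max => /andP[bb' cb']; exists b'; split=> // x.
  by have [h1 h2] := bP x; split=> [/h1|/h2] /le_lt_trans; apply.
have [u [s [u0 uS us sl]]] := ray_iter_sup hL a (f := fun=> h) (fun _ x => (hP x).1).
exists s; last by rewrite -u0.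
have ltsP x : (x < s)%O -> exists n, (x <= u n)%O.
  move=> xs; apply: contrapT => /forallNP H; move: xs; rewrite ltNge => /negP; apply.
  by apply: sl => n; rewrite leNgt; apply/negP => xu; apply: (H n); exact: ltW.
move=> x [[/ltsP[n fu] sg]|[/ltsP[n gu] sf]].
  have := ((hP (u n)).2 x).1 fu; rewrite -(uS n) => gu.
  by have := lt_trans (lt_trans gu (us _)) sg; rewrite ltxx.
have := ((hP (u n)).2 x).2 gu; rewrite -(uS n) => fu.
by have := lt_trans (lt_trans fu (us _)) sf; rewrite ltxx.
Qed.

(** The possible tops of an initial segment containing both values, kept as a set so that a choice
    made from it depends on [x] through this set only. *)
Let S (x : X) : set L := [set c | C c /\ (f x <= c)%O /\ (g x <= c)%O].

(** A point [z] strictly between the two values stays between them nearby. As no point of [C]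
    separates the values, being above both then amounts to being above [z]. *)
Let S_near (x : X) : f x != g x -> \forall y \near x, S y = S x.
Proof.
suff H z : (f x < z /\ z < g x)%O \/ (g x < z /\ z < f x)%O ->
    \forall y \near x, S y = [set c | C c /\ (z <= c)%O].
  move=> fgx; have [z zP] : exists z, (f x < z /\ z < g x)%O \/ (g x < z /\ z < f x)%O.
    move: fgx; rewrite neq_lt => /orP[|] /(ray_dense hL)[z h1 h2]; exists z; by [left|right].
  have near_S := H z zP; have Sx := nbhs_singleton near_S.
  by apply: filterS near_S => y ->.
case=> [[fz zg]|[gz zf]].
  have fn : \forall y \near x, (f y < z)%O by exact: near_continuous_lt.
  have gn : \forall y \near x, (z < g y)%O by exact: near_continuous_gt.
  apply: filterS2 fn gn => y fy gy; apply/seteqP; split=> c /= [Cc].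
    by move=> [_ gc]; split=> //; exact: le_trans (ltW gy) gc.
  move=> zc; have fc := lt_le_trans fy zc; do 2?split => //; first exact: ltW.
  by rewrite leNgt; apply/negP => cgy; apply: (Cc y); left.
have gn : \forall y \near x, (g y < z)%O by exact: near_continuous_lt.
have fn : \forall y \near x, (z < f y)%O by exact: near_continuous_gt.
apply: filterS2 fn gn => y fy gy; apply/seteqP; split=> c /= [Cc].
  by move=> [fc _]; split=> //; exact: le_trans (ltW fy) fc.
move=> zc; have gc := lt_le_trans gy zc; do 2?split => //; last exact: ltW.
by rewrite leNgt; apply/negP => cfy; apply: (Cc y); right.
Qed.

Lemma coarse_homotopic : homotopic R f g.
Proof.
(* Choosing from the set, and not for the point, makes [al] constant wherever [S] is. *)
have /choice[pick pickP] : forall T : set L, exists a, T !=set0 -> T a.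
  move=> T; have [[a Ta]|N] := pselect (T !=set0); first by exists a.
  by have [a _] := ray_inhabited hL; exists a.
pose al x := pick (S x).
have alP x : S x (al x).
  apply: pickP; have [c Cc] := C_unbounded (Order.max (f x) (g x)).
  by rewrite gt_max => /andP[/ltW fc /ltW gc]; exists c.
have /choice[e eP] := ray_embed hL.
pose r (p : X * R) := (1 - p.2) * e (al p.1) (f p.1) + p.2 * e (al p.1) (g p.1).
(* [H] pulls the interpolated coordinate back to the ray by the intermediate value theorem; times
   outside [0, 1] carry no constraint. *)
have /choice[H HP] : forall p : X * R, exists z, 0 <= p.2 <= 1 ->
    [/\ (Order.min (f p.1) (g p.1) <= z)%O, (z <= Order.max (f p.1) (g p.1))%O
       & e (al p.1) z = r p].
  move=> [x t] /=; have [t01|N] := pselect (0 <= t <= 1); last by exists (f x).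
  have [ce me _] := eP (al x); have /andP[t0 t1] := t01.
  rewrite /r /=; have [fgx|gfx] := leP (f x) (g x).
    have [||z /andP[fz zg] ez] := @ray_ivt R d L hL (e (al x)) (f x) (g x) (r (x, t)) ce => //.
      by have := me _ _ fgx; rewrite /r /= => h; apply/andP; split; nra.
    by exists z.
  have gfx' := ltW gfx.
  have [||z /andP[gz zf] ez] := @ray_ivt R d L hL (e (al x)) (g x) (f x) (r (x, t)) ce => //.
    by have := me _ _ gfx'; rewrite /r /= => h; apply/andP; split; nra.
  by exists z.
have e_inj x y z : (y <= al x)%O -> (z <= al x)%O -> e (al x) y = e (al x) z -> y = z.
  have [_ _ ie] := eP (al x); move=> ya za eyz.
  by case: (ltgtP y z) => // /ie /(_ _); rewrite eyz ltxx => /(_ ltac:(by [])).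
have H_al p : 0 <= p.2 <= 1 -> (H p <= al p.1)%O.
  move=> /HP[_ Hm _]; apply: le_trans Hm _; have [_ [fa ga]] := alP p.1.
  by rewrite ge_max fa ga.
exists H; split.
- pose D : set (X * R) := [set: X] `*` `[0, 1]%classic.
  suff HC (x0 : X * R) : 0 <= x0.2 <= 1 ->
      (forall b, (b < H x0)%O -> \forall p \near x0, D p -> (b < H p)%O) /\
      (forall b, (H x0 < b)%O -> \forall p \near x0, D p -> (H p < b)%O).
    apply: (within_continuous_rayP hL) => x0 [_]; rewrite /= in_itv /= => t01 b.
      exact: (HC x0 t01).1.
    exact: (HC x0 t01).2.
  move=> t01; set x := x0.1; set t := x0.2.
  have [Hlo Hhi eH] := HP x0 t01; rewrite -/x in Hlo Hhi eH.
  have fst_near (P : set X) : (\forall y \near x, P y) ->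
      \forall p \near x0, P p.1 by move=> nP; exact: (@cvg_fst X R (nbhs x) (nbhs t) _ P nP).
  (* Where the maps agree, [al] may jump, but [H] is squeezed between their minimum and maximum. *)
  have [fgx|fgx] := eqVneq (f x) (g x).
    have Hx : H x0 = f x.
      by apply/eqP; rewrite eq_le; move: Hlo Hhi; rewrite -fgx minxx maxxx => -> ->.
    rewrite Hx; split => b.
      move=> bf; have bg : (b < g x)%O by rewrite -fgx.
      have fn : \forall y \near x, (b < f y)%O by exact: near_continuous_gt.
      have gn : \forall y \near x, (b < g y)%O by exact: near_continuous_gt.
      apply: filterS2 (fst_near _ fn) (fst_near _ gn) => p fp gp [_]; rewrite /= in_itv /= => /HP[lo _ _].
      by apply: lt_le_trans lo; rewrite lt_min fp gp.
    move=> fb; have gb : (g x < b)%O by rewrite -fgx.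
    have fn : \forall y \near x, (f y < b)%O by exact: near_continuous_lt.
    have gn : \forall y \near x, (g y < b)%O by exact: near_continuous_lt.
    apply: filterS2 (fst_near _ fn) (fst_near _ gn) => p fp gp [_]; rewrite /= in_itv /= => /HP[_ hi _].
    by apply: le_lt_trans hi _; rewrite gt_max fp gp.
  have aln := fst_near _ (S_near fgx).
  have [ce me ie] := eP (al x).
  pose ph (p : X * R) := (1 - p.2) * e (al x) (f p.1) + p.2 * e (al x) (g p.1).
  have phc : ph @ x0 --> ph x0.
    have cfst (h : X -> L) : continuous h ->
        (fun p : X * R => e (al x) (h p.1)) @ x0 --> e (al x) (h x).
      move=> ch; apply: (@continuous_comp _ _ _ (h \o fst) (e (al x)) x0); last exact: ce.
      by apply: continuous_comp; [exact: cvg_fst|exact: ch].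
    by apply: cvgD; apply: cvgM; [apply: cvgB; [exact: cvg_cst|exact: cvg_snd]|exact: cfst|exact: cvg_snd|exact: cfst].
  have phH p : S p.1 = S x -> 0 <= p.2 <= 1 -> e (al x) (H p) = ph p.
    by move=> Sp /HP[_ _]; rewrite /ph /r /al Sp.
  have e_lt y z : e (al x) y < e (al x) z -> (y < z)%O.
    by rewrite ltNge; apply: contraNlt => /me.
  split => b.
    move=> bH; have : e (al x) b < ph x0.
      by rewrite -phH//; apply: ie => //; exact: H_al.
    move=> /(cvgr_gt _ phc) phn; apply: filterS2 phn aln => p phb Sp [_].
    by rewrite /= in_itv /= => p01; apply: e_lt; rewrite phH.
  (* Above [al x] the coordinate is not known to be strict; there the bound of [H] by the locally
     constant [al] suffices. *)
  move=> Hb; have [ba|ab] := leP b (al x).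
    have : ph x0 < e (al x) b by rewrite -phH//; apply: ie.
    move=> /(cvgr_lt _ phc) phn; apply: filterS2 phn aln => p phb Sp [_].
    by rewrite /= in_itv /= => p01; apply: e_lt; rewrite phH.
  apply: filterS aln => p Sp [_]; rewrite /= in_itv /= => p01.
  by apply: le_lt_trans (H_al _ p01) _; rewrite /al Sp.
- move=> x; have t01 : 0 <= (x, 0 : R).2 <= 1 by rewrite /= lexx ler01.
  apply: (e_inj x); [exact: H_al t01|by case: (alP x) => _ []|].
  by have [_ _ ->] := HP _ t01; rewrite /r /= subr0 mul1r mul0r addr0.
- move=> x; have t01 : 0 <= (x, 1 : R).2 <= 1 by rewrite /= lexx ler01.
  apply: (e_inj x); [exact: H_al t01|by case: (alP x) => _ []|].
  by have [_ _ ->] := HP _ t01; rewrite /r /= subrr mul0r mul1r add0r.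
Qed.
End coarse_homotopy.

(** * Rigidity *)

(** Compactness in covering form is applied to the filter on sets [V] generated by the supersets
    with [Q] of each set with [Q]; eventually such a [V] covers [A]. *)
Lemma compact_induction (T : topologicalType) (A : set T) (Q : set T -> Prop) :
  compact A -> Q set0 -> (forall U V, Q U -> Q V -> Q (U `|` V)) ->
  (forall x, A x -> exists2 U, nbhs x U & Q U) -> exists2 V, Q V & A `<=` V.
Proof.
move=> /compact_near_coveringP cA Q0 QU nQ.
pose F := filter_from Q (fun U => [set V | Q V /\ U `<=` V]).
have FF : Filter F.
  apply: filter_from_filter; first by exists set0.
  move=> U V QU' QV; exists (U `|` V); first exact: QU.
  by move=> S [QS]; rewrite subUset => -[? ?].
have [x Ax|V QV VP] := cA _ F (fun V x => V x) FF.
  have [U xU QU'] := nQ x Ax; exists (U, [set V | Q V /\ U `<=` V]).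
    by split => //; exists U.
  by move=> [y V] [/= Uy [_ UV]]; exact: UV.
by exists V => //; apply: (VP V); split => //; exact: subset_refl.
Qed.

Section bounded_homotopy.
Variables (R : realType) (d : Order.disp_t) (L : orderTopologicalType d).
Hypothesis hL : ray_like R L.

Lemma ray_compact_bounded (A : set L) : compact A ->
  exists b, forall x, A x -> (x <= b)%O.
Proof.
move=> cA; have [x0 _] := ray_inhabited hL.
have [||x _|V [b Vb] AV] := @compact_induction L A
    (fun U => exists b, forall x, U x -> (x <= b)%O) cA.
- by exists x0.
- move=> U V [b Ub] [c Vc]; exists (Order.max b c) => x.
  by by rewrite le_max => -[/Ub ->|/Vc ->]; rewrite ?orbT.
- have [b xb] := ray_nomax hL x; exists [set z | (z < b)%O]; first exact: near_ray_lt.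
  by exists b => z /ltW.
by exists b => x /AV /Vb.
Qed.

Variables (Y : topologicalType) (Z : Type) (p : Z -> L) (X : set Z) (H : Z -> R -> L).
(* Over a neighborhood of each y, X is represented by a compact set of parameters; this
   spares us the continuity of scaling on the tangent bundle. *)
Hypothesis loc : forall y : L, exists (K : set Y) (pK : Y -> L) (HK : Y * R -> L),
  [/\ compact K, continuous pK, continuous HK,
    (forall k, K k -> exists2 x, X x & p x = pK k /\ forall t, H x t = HK (k, t)) &
    \forall z \near y, forall x, X x -> p x = z ->
      exists2 k, K k & pK k = p x /\ forall t, HK (k, t) = H x t].

Let E (b : L) (q : R) : set L :=
  [set y | exists2 x, X x & p x = y /\ exists2 t, 0 <= t <= q & (b <= H x t)%O].

Let slice (K : set Y) (HK : Y * R -> L) (b : L) (q : R) : set (Y * R) :=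
  (K `*` `[0, q]%classic) `&` [set z | (b <= HK z)%O].

Let slice_compact K HK b q : compact K -> continuous HK -> compact (slice K HK b q).
Proof.
move=> cK cHK; apply: compact_closedI.
  by apply: compact_setX => //; exact: segment_compact.
exact: ((continuous_closedP HK).1 cHK _ (@closed_ray_ge _ _ b)).
Qed.

(** Near any point, [E b q] is the image of a compact [slice] under the continuous map [pK]. *)
Let E_closed b q : closed (E b q).
Proof.
move=> y clEy; have [K [pK [HK [cK cpK cHK KX KP]]]] := loc y.
have cI : closed ((pK \o fst) @` slice K HK b q).
  apply: compact_closed; first exact: order_hausdorff.
  apply: continuous_compact; last exact: slice_compact.
  by apply: continuous_subspaceT => z; apply: continuous_comp; [exact: cvg_fst|exact: cpK].
have [[k t] [[/= Kk tq] bH] <-] : ((pK \o fst) @` slice K HK b q) y.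
  apply: cI => U Uy.
  have [z [[x Xx [pxz [t tq bH]]] [Uz zP]]] := clEy _ (filterI Uy KP).
  have [k Kk [pk kH]] := zP x Xx pxz.
  exists z; split=> //; exists (k, t); last by rewrite /= pk.
  by split; [split=> //=; rewrite in_itv|rewrite /= kH].
have [x Xx [px Hx]] := KX k Kk; exists x => //; split=> //.
by exists t; [move: tq; rewrite in_itv|rewrite Hx].
Qed.

(** Compact induction along the segment of base points: near each of them [H] takes its values in
    the compact image of [K] times [0, 1]. *)
Lemma bounded_below (a : L) : exists b, forall x t, X x -> (p x <= a)%O -> 0 <= t <= 1 -> (H x t <= b)%O.
Proof.
have [x0 x0min] := ray_min hL.
have [||y _|V [b Vb] AV] := @compact_induction L [set z | (x0 <= z <= a)%O]
    (fun U => exists b, forall x t, X x -> U (p x) -> 0 <= t <= 1 -> (H x t <= b)%O)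
    (@ray_segment_compact _ _ _ hL x0 a).
- by exists x0.
- move=> U V [b Ub] [c Vc]; exists (Order.max b c) => x t Xx.
  by move=> -[/(Ub x t Xx)|/(Vc x t Xx)] h /h; rewrite le_max => ->; rewrite ?orbT.
- have [K [pK [HK [cK cpK cHK KX KP]]]] := loc y.
  have [b bP] : exists b, forall y, (HK @` (K `*` `[0, 1]%classic)) y -> (y <= b)%O.
    apply: ray_compact_bounded; apply: continuous_compact; first exact: continuous_subspaceT.
    by apply: compact_setX => //; exact: segment_compact.
  eexists; [exact: KP|exists b => x t Xx /(_ x Xx erefl)[k Kk [pk kH]] t01].
  by apply: bP; exists (k, t); [split => //=; rewrite in_itv|exact: kH].
by exists b => x t Xx pxa; apply: Vb => //; apply: AV; rewrite /= x0min.
Qed.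

(** At the least level and time 0 the condition defining [E] always holds. *)
Lemma closed_base_image : closed (p @` X).
Proof.
have [x0 x0min] := ray_min hL.
have -> : p @` X = E x0 0; last exact: E_closed.
apply/seteqP; split => [_ [x Xx <-]|y [x Xx [px _]]]; last by exists x.
by exists x => //; split => //; exists 0; rewrite ?lexx.
Qed.

Lemma bounded_homotopy (c : L) : (forall x, X x -> (H x 0 <= c)%O) ->
  exists b, forall x t, X x -> 0 <= t <= 1 -> (H x t <= b)%O.
Proof.
move=> H0c; apply: contrapT => /forallNP unb.
have {}unb b : exists x t, [/\ X x, 0 <= t <= 1 & (b < H x t)%O].
  apply: contrapT => N; apply: (unb b) => x t Xx t01; rewrite leNgt; apply/negP => bH.
  by apply: N; exists x, t.
pose good q := forall b, ray_unbounded (E b q).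
have good1 : good 1.
  move=> b a; have [b' b'P] := bounded_below a.
  have [x [t [Xx t01]]] := unb (Order.max b b'); rewrite gt_max => /andP[bH b'H].
  exists (p x); first by exists x => //; split => //; exists t => //; exact: ltW.
  by rewrite ltNge; apply/negP => pxa; move: b'H; rewrite ltNge b'P.
(* An enumeration of the rationals; numbers that code nothing give 0. *)
pose q n : R := ratr (odflt 0 (unpickle n : option rat)).
have qE (r : rat) : q (pickle r) = ratr r by rewrite /q pickleK.
(* For a time that is not good, [D n] records a level together with a bound for its [E]; [d0] and
   [a0] below dominate all of these at once. *)
have /choice[D DP] : forall n, exists db : L * L, ~ good (q n) ->
    forall y, E db.1 (q n) y -> (y <= db.2)%O.
  move=> n; have [x0 _] := ray_inhabited hL.
  have [g|/existsNP[b /existsNP[a N]]] := pselect (good (q n)); first by exists (x0, x0).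
  exists (b, a) => _ y Ey; rewrite leNgt; apply/negP => ay; apply: N; by exists y.
have [d0 d0P] := ray_seq_bounded hL (fun n => (D n).1).
have [a0 a0P] := ray_seq_bounded hL (fun n => (D n).2).
(* Taking [c] into account keeps the level [d2] out of reach at time 0; the strict gap from [d1] to
   [d2] leaves times before the first arrival at [d2] when [d1] is already exceeded. *)
pose d1 := Order.max d0 c.
have [d2 d12] := ray_nomax hL d1.
pose C n := [set y | good (q n) -> E d2 (q n) y].
have CE n : C n = if `[< good (q n) >] then E d2 (q n) else setT.
  rewrite /C; case: asboolP => [g|N]; apply/seteqP; split=> y //=; exact.
have [|n|y Cy a0y] := @ray_club_bigcap R d L hL C _ _ a0.
- by move=> n; rewrite CE; case: ifP => _; [exact: E_closed|exact: closedT].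
- rewrite CE; case: asboolP => [g|_]; first exact: g.
  by move=> a; have [b ab] := ray_nomax hL a; exists b.
have Ey n : good (q n) -> E d2 (q n) y by apply: Cy.
have [K [pK [HK [cK cpK cHK KX KP]]]] := loc y.
(* The least time coordinate on this compact set is the first time [t0] at which [d2] is reached
   over [y]. *)
pose S := slice K HK d2 1 `&` [set z | pK z.1 = y].
have cS : compact S.
  apply: compact_closedI; first exact: slice_compact.
  apply: ((continuous_closedP (pK \o fst)).1 _ [set y]); last first.
    exact/accessible_closed_set1/hausdorff_accessible/order_hausdorff.
  by move=> z; apply: continuous_comp; [exact: cvg_fst|exact: cpK].
have ES t : 0 <= t <= 1 -> (exists2 x, X x & p x = y /\ (d2 <= H x t)%O) -> exists k, S (k, t).
  move=> t01 [x Xx [px d2H]].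
  have [k Kk [pk kH]] := nbhs_singleton KP x Xx px.
  exists k; split; last by rewrite /= pk.
  by split; [split=> //=; rewrite in_itv|rewrite /= kH].
have S0 : S !=set0.
  have := Ey (pickle (1 : rat)); rewrite qE rmorph1 => /(_ good1)[x Xx [px [t t01 d2H]]].
  by have [|k Sk] := ES t t01; [exists x|exists (k, t)].
have [|[k0 t0] kt0 tmin] := @compact_EVT_min _ _ snd S S0 cS.
  by apply: continuous_subspaceT => z; exact: cvg_snd.
have [[[/= Kk0]]] : S (k0, t0) by rewrite inE in kt0.
rewrite in_itv /= => /andP[t00 t01] d2H pk0.
have [z0 Xz0 [pz0 Hz0]] := KX _ Kk0; rewrite pk0 in pz0.
have tpos : 0 < t0.
  rewrite lt_neqAle t00 andbT eq_sym; apply/negP => /eqP t0E.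
  have := H0c _ Xz0; rewrite leNgt Hz0 -t0E => /negP; apply.
  by apply: lt_le_trans d2H; apply: le_lt_trans d12; rewrite le_max lexx orbT.
have ct : {for t0, continuous (fun t => HK (k0, t))}.
  have : continuous (pair k0 : R -> Y * R).
    move=> t U [[A B] /= [Ak Bt] AB].
    by apply: filterS Bt => s Bs; apply: AB; split => //; exact: nbhs_singleton.
  by move=> /(_ t0) h; apply: (@continuous_comp _ _ _ (pair k0) HK); [exact: h|exact: cHK].
have [e /= e0 eP] : \forall t \near t0, (d1 < HK (k0, t))%O.
  have d1H := lt_le_trans d12 d2H; exact: (ct _ (near_ray_gt d1H)).
(* A rational time just before [t0], with [H] above [d1] by continuity. *)
have /rat_in_itvoo[r] : Num.max 0 (t0 - e) < t0 by rewrite gt_max tpos ltrBlDr ltrDl.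
rewrite in_itv /= gt_max => /andP[/andP[r0 er] rt0].
have Hr : (d1 < H z0 (ratr r))%O.
  by rewrite Hz0; apply: eP; rewrite /ball /= ltr_norml; apply/andP; split; lra.
have Er : E d1 (q (pickle r)) y.
  rewrite qE; exists z0 => //.
  by split=> //; exists (ratr r); [rewrite (ltW r0) lexx|exact: ltW].
(* If [r] is good, the choice of [y] puts an arrival at [d2] before [t0]; if not, [y] would lie
   below [a0]. *)
have [g|g] := pselect (good (q (pickle r))).
  have [x Xx [px [t /andP[t0' tr] d2Ht]]] := Ey _ g; rewrite qE in tr.
  have tt0 := le_lt_trans tr rt0.
  have [||k Sk] := ES t; first by rewrite t0' (ltW (lt_le_trans tt0 t01)).
    by exists x.
  by have := tmin _ (mem_set Sk); rewrite /= leNgt tt0.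
have : E (D (pickle r)).1 (q (pickle r)) y.
  have [x Xx [px [t tr dHt]]] := Er; exists x => //; split => //; exists t => //.
  by apply: le_trans dHt; apply: (le_trans (ltW (d0P _))); rewrite le_max lexx.
move=> /(DP _ g); rewrite leNgt => /negP; apply.
exact: lt_trans (a0P _) a0y.
Qed.
End bounded_homotopy.

(** * Charts and tangent vectors *)

Section half_derivative.
Variable R : realType.
Implicit Types (f g : R -> R) (x : R).

Lemma derivable_slope g x : derivable g x 1 ->
  (fun h => h^-1 * (g (x + h) - g x)) @ 0^' --> 'D_1 g x.
Proof.
move=> dg; have -> : (fun h => h^-1 * (g (x + h) - g x)) =
    (fun h => h^-1 *: ((g \o shift x) (h *: 1) - g x)).
  by apply/funext => h; rewrite [x + h]addrC /= [h *: 1]mulr1.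
exact: dg.
Qed.

(** Increments staying in the half-line accumulate at 0 even when [x] is 0, so the limit is unique;
    along them [f] has the difference quotients of [g]. *)
Lemma half_deriveE f g x : half_line x -> derivable g x 1 ->
  (\forall y \near x, half_line y -> f y = g y) -> half_derive f x = 'D_1 g x.
Proof.
move=> x0 dg fg; apply: cvg_lim => //.
  split; last exact: within_filter.
  move=> [e /= e0 eP]; have := eP (e / 2); rewrite /ball /= sub0r normrN gtr0_norm ?divr_gt0//.
  rewrite ltr_pdivrMr// mulr_natr mulr2n ltrDl e0 => /(_ isT); apply.
    by rewrite gt_eqF// divr_gt0.
  move: x0; rewrite /half_line /= !in_itv /= !andbT => x0.
  by rewrite addr_ge0// divr_ge0// ltW.
have fgx : f x = g x := nbhs_singleton fg x0.
have gl := derivable_slope dg.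
have : (fun h => h^-1 * (g (x + h) - g x)) @ within [set h | half_line (x + h)] 0^' --> 'D_1 g x.
  move=> U /gl nU.
  have {}nU : \forall h \near 0^', U (h^-1 * (g (x + h) - g x)) := nU.
  change (\forall h \near 0^', half_line (x + h) -> U (h^-1 * (g (x + h) - g x))).
  by apply: filterS nU => h Uh _.
apply: cvg_trans; apply: near_eq_cvg.
have nf : \forall h \near 0^', half_line (x + h) -> f (x + h) = g (x + h).
  apply: nbhs_dnbhs.
  have : (fun h => x + h) @ (0 : R) --> x.
    by rewrite -[X in _ --> X]addr0; apply: cvgD; [exact: cvg_cst|exact: cvg_id].
  by move=> /(_ _ fg).
rewrite near_withinE; apply: filterS nf => h nf /nf ->.
by rewrite fgx.
Qed.
End half_derivative.

Section chart_theory.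
Variables (R : realType) (X : topologicalType).
Implicit Types (c : chart R X) (p q : X).

Lemma chart_continuous c p : cdom c p -> {for p, continuous (cmap c)}.
Proof.
move=> cp; have := @cmap_continuous _ _ c; rewrite continuous_open_subspace; last exact: cdom_open.
by apply; rewrite inE.
Qed.

Lemma chart_half_line c p : cdom c p -> half_line (cmap c p).
Proof.
move=> cp; have [V oV VE] := @cmap_open _ _ c.
by have [] : (V `&` @half_line R) (cmap c p) by rewrite -VE; exists p.
Qed.

Lemma chartK c p : cdom c p -> cinv c (cmap c p) = p.
Proof. by move=> cp; apply: cmapK; rewrite inE. Qed.

Lemma chart_inj c p q : cdom c p -> cdom c q -> cmap c p = cmap c q -> p = q.
Proof. by move=> cp cq pq; rewrite -(chartK cp) pq chartK. Qed.

(** Charts are open maps relative to the half-line, by continuity of [cinv] on the relatively open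
    image. *)
Lemma chart_near c p (U : set X) : cdom c p -> nbhs p U ->
  \forall y \near cmap c p, half_line y -> exists q, [/\ cdom c q, U q & cmap c q = y].
Proof.
move=> cp pU; have [V oV VE] := @cmap_open _ _ c.
have /subspace_continuousP/(_ (cmap c p)) ci := @cinv_continuous _ _ c.
have Vp : V (cmap c p) by have [] : (V `&` @half_line R) (cmap c p) by rewrite -VE; exists p.
have U' : nbhs (cinv c (cmap c p)) U by rewrite chartK.
have nU : \forall y \near cmap c p, (cmap c @` cdom c) y -> U (cinv c y) := ci (imageP _ cp) _ U'.
have nV : \forall y \near cmap c p, V y by exact: open_nbhs_nbhs.
apply: filterS2 nU nV => y yU Vy y0.
have [q cq qy] : (cmap c @` cdom c) y by rewrite VE.
exists q; split => //; have : (cmap c @` cdom c) y by exists q.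
by move/yU; rewrite -qy chartK.
Qed.

Definition chart_deriv c c' p := half_derive (transition c c') (cmap c p).

Lemma transition_ext c c' p : compatible c c' -> cdom c p -> cdom c' p ->
  exists2 g : R -> R, derivable g (cmap c p) 1 &
    \forall y \near cmap c p, half_line y -> transition c c' y = g y.
Proof.
move=> [sm _] cp c'p; have [|V [g [oV Vx dg fg]]] := sm (cmap c p); first by exists p.
exists g; first exact: (dg 0%N).
have nV : \forall y \near cmap c p, V y by exact: open_nbhs_nbhs.
have nc := chart_near cp (open_nbhs_nbhs (conj (cdom_open c') c'p)).
apply: filterS2 nV nc => y Vy + y0 => /(_ y0)[q [cq c'q qy]].
by apply: fg => //; exists q.
Qed.

Lemma transitionE c c' p : cdom c p -> transition c c' (cmap c p) = cmap c' p.
Proof. by move=> cp; rewrite /transition /= chartK. Qed.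

Lemma chart_deriv_refl c p : cdom c p -> chart_deriv c c p = 1.
Proof.
move=> cp; rewrite /chart_deriv (half_deriveE (g := id) (chart_half_line cp)).
- exact: derive_id.
- exact: derivable_id.
have nc := chart_near cp (open_nbhs_nbhs (conj (cdom_open c) cp)).
by apply: filterS nc => y + y0 => /(_ y0)[q [cq _ <-]]; rewrite transitionE.
Qed.

Lemma chart_deriv_chain c c' c'' p : compatible c c' -> compatible c' c'' ->
  cdom c p -> cdom c' p -> cdom c'' p ->
  chart_deriv c c'' p = chart_deriv c' c'' p * chart_deriv c c' p.
Proof.
move=> cc' cc'' cp c'p c''p.
have [g1 dg1 g1E] := transition_ext cc' cp c'p.
have [g2 dg2 g2E] := transition_ext cc'' c'p c''p.
have g1p : g1 (cmap c p) = cmap c' p.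
  by rewrite -(nbhs_singleton g1E (chart_half_line cp)) transitionE.
rewrite /chart_deriv (half_deriveE (chart_half_line c'p) dg2 g2E).
rewrite (half_deriveE (chart_half_line cp) dg1 g1E).
have dg2' : derivable g2 (g1 (cmap c p)) 1 by rewrite g1p.
have cg1 : {for cmap c p, continuous g1}.
  exact: (differentiable_continuous ((derivable1_diffP _ _).1 dg1)).
have dg : derivable (g2 \o g1) (cmap c p) 1.
  apply: ((derivable1_diffP _ _).2 (differentiable_comp _ _)).
    exact: ((derivable1_diffP _ _).1 dg1).
  exact: ((derivable1_diffP _ _).1 dg2').
rewrite (half_deriveE (g := g2 \o g1) (chart_half_line cp) dg).
  by have := derive1_comp dg1 dg2'; rewrite !derive1E g1p.
have ng2 : \forall y \near cmap c p, half_line (g1 y) -> transition c' c'' (g1 y) = g2 (g1 y).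
  have g2E' : \forall y \near g1 (cmap c p), half_line y -> transition c' c'' y = g2 y by rewrite g1p.
  exact: (cg1 _ g2E').
have nc := chart_near cp (open_nbhs_nbhs (conj (openI (cdom_open c') (cdom_open c'')) (conj c'p c''p))).
apply: filterS3 g1E ng2 nc => y g1y g2y + y0 => /(_ y0)[q [cq [c'q c''q] qy]].
have {}g1y := g1y y0; rewrite -qy transitionE// in g1y.
rewrite -qy transitionE//= -g1y in g2y *.
by rewrite -g2y ?transitionE//; exact: chart_half_line.
Qed.

(** The derivative is nonzero by the chain rule, so difference quotients near [p] share its sign;
    multiplying by the square of the increment clears the denominator. *)
Lemma chart_deriv_sign c c' p : compatible c c' -> compatible c' c -> cdom c p -> cdom c' p ->
  \forall q \near p, q != p -> 0 < chart_deriv c c' p * (cmap c' q - cmap c' p) * (cmap c q - cmap c p).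
Proof.
move=> cc' c'c cp c'p.
have [g dg gE] := transition_ext cc' cp c'p.
have D0 : chart_deriv c c' p != 0.
  apply/eqP => D0; have := chart_deriv_chain cc' c'c cp c'p cp.
  by rewrite chart_deriv_refl// D0 mulr0 => /eqP; rewrite oner_eq0.
have DE : chart_deriv c c' p = 'D_1 g (cmap c p) := half_deriveE (chart_half_line cp) dg gE.
set D := chart_deriv c c' p in D0 DE *; set x := cmap c p in dg gE DE *.
have DD : D * 'D_1 g x = D ^+ 2 by rewrite -DE expr2.
have slope : (fun h => D * (h^-1 * (g (x + h) - g x))) @ 0^' --> D ^+ 2.
  by rewrite -DD; apply: cvgM; [exact: cvg_cst|exact: derivable_slope].
have D2 : 0 < D ^+ 2 by rewrite exprn_even_gt0.
have nh : \forall h \near (0 : R), h != 0 -> 0 < D * (h^-1 * (g (x + h) - g x)).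
  exact: (cvgr_gt _ slope _ D2).
have hq : (fun q => cmap c q - x) @ p --> (0 : R).
  by rewrite -(subrr x); apply: cvgB; [exact: chart_continuous|exact: cvg_cst].
have nq : \forall q \near p, cmap c q - x != 0 ->
    0 < D * ((cmap c q - x)^-1 * (g (x + (cmap c q - x)) - g x)) := hq _ nh.
have nc : \forall q \near p, cdom c q by apply: open_nbhs_nbhs; split => //; exact: cdom_open.
have nc' : \forall q \near p, cdom c' q by apply: open_nbhs_nbhs; split => //; exact: cdom_open.
have ng : \forall q \near p, half_line (cmap c q) -> transition c c' (cmap c q) = g (cmap c q).
  exact: (chart_continuous cp gE).
have gx : g x = cmap c' p by rewrite -(nbhs_singleton gE (chart_half_line cp)) transitionE.
near=> q => qp.
have qP : cmap c q - x != 0 ->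
    0 < D * ((cmap c q - x)^-1 * (g (x + (cmap c q - x)) - g x)) by near: q.
have cq : cdom c q by near: q.
have c'q : cdom c' q by near: q.
have gq : half_line (cmap c q) -> transition c c' (cmap c q) = g (cmap c q) by near: q.
have h0 : cmap c q - x != 0.
  by rewrite subr_eq0; apply: contraNneq qp => /(chart_inj cq cp) ->.
have := qP h0; rewrite [x + _]addrC subrK -gq; last exact: chart_half_line.
rewrite transitionE// gx => pos.
have := mulr_gt0 pos (_ : 0 < (cmap c q - x) ^+ 2); rewrite exprn_even_gt0 ?h0 ?orbT// => /(_ isT).
congr (0 < _); field.
exact: h0.
Unshelve. all: by end_near. Qed.

Variable A : smooth_structure R X.

(** The component in [c] determines the others, and the chain rule makes them coherent. *)
Lemma tangent_vec c p s : atlas A c -> cdom c p -> exists v : tangent A,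
  [/\ tbase v = p, tcomp v c = s &
     forall c', atlas A c' -> cdom c' p -> tcomp v c' = chart_deriv c c' p * s].
Proof.
move=> Ac cp.
pose f c' := if `[< atlas A c' /\ cdom c' p >] then chart_deriv c c' p * s else 0.
have f0 c' : ~ (atlas A c' /\ cdom c' p) -> f c' = 0 by rewrite /f => /asboolF ->.
have fE c' : atlas A c' -> cdom c' p -> f c' = chart_deriv c c' p * s.
  by move=> Ac' c'p; rewrite /f asboolT.
have fC c1 c2 : atlas A c1 -> atlas A c2 -> cdom c1 p -> cdom c2 p ->
    f c2 = half_derive (transition c1 c2) (cmap c1 p) * f c1.
  move=> A1 A2 p1 p2; rewrite !fE// mulrA -[half_derive _ _]/(chart_deriv c1 c2 p).
  by rewrite -chart_deriv_chain//; exact: (@atlas_compatible _ _ A).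
exists (Tangent fC f0); split => //=.
by rewrite fE// chart_deriv_refl// mul1r.
Qed.

Lemma tangent_ext (v w : tangent A) :
  tbase v = tbase w -> (forall c, tcomp v c = tcomp w c) -> v = w.
Proof.
case: v w => [p f vE v0] [q g wE w0] /= pq /funext fg; subst.
by congr Tangent; exact: Prop_irrelevance.
Qed.

Lemma tangent_eq_chart c (v w : tangent A) : atlas A c -> cdom c (tbase v) ->
  tbase v = tbase w -> tcomp v c = tcomp w c -> v = w.
Proof.
move=> Ac cv vw vwc; apply: tangent_ext => // c'.
have [[Ac' c'v]|N] := pselect (atlas A c' /\ cdom c' (tbase v)); last first.
  by rewrite !tcomp0// -vw.
by rewrite (tcompE Ac Ac' cv c'v) vw vwc -(tcompE Ac Ac') -?vw.
Qed.

Lemma tangent_openE (V : set (tangent A)) : open V = tangent_open V.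
Proof. by []. Qed.

Lemma tbase_continuous : continuous (@tbase R X A).
Proof.
apply/continuousP => B oB; rewrite tangent_openE => c Ac.
(* [P] holds off the half-line too, so that the coordinate 0 of a boundary point can be interior to
   it. *)
pose P (y : R) := half_line y -> exists q, [/\ cdom c q, B q & cmap c q = y].
exists [set z | \forall y \near z.1, P y].
  rewrite -[X in open X]/(fst @^-1` [set y | \forall y' \near y, P y']).
  apply: open_comp; first by move=> z _; exact: cvg_fst.
  exact: (@open_interior _ P).
move=> v cv; split => [Bv|/= /nbhs_singleton/(_ (chart_half_line cv))[q [cq Bq qv]]].
  exact: (chart_near cv (open_nbhs_nbhs (conj oB Bv))).
by rewrite /= -(chart_inj cq cv qv).
Qed.
End chart_theory.

(** * Local trivializations of the bundle of increasing vectors *)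

Section ray_tangent.
Variables (R : realType) (d : Order.disp_t) (L : orderTopologicalType d).
Hypothesis hL : ray_like R L.
Variable A : smooth_structure R L.
Implicit Types (c : chart R L) (a b x y : L).

(** Read through [ray_param], the chart is a continuous injection of a real interval, hence
    monotone; [s] is its orientation. *)
Lemma chart_monotone c a b : (a < b)%O ->
  (forall z, (a <= z <= b)%O -> cdom c z) ->
  exists2 s : R, s ^+ 2 = 1 & forall x y, (a <= x)%O -> (x < y)%O -> (y <= b)%O ->
    0 < s * (cmap c y - cmap c x).
Proof.
move=> ab dom; have [u [v [k [ck kab kmono kS]]]] := ray_param hL (ltW ab).
have cf : {within `[u, v]%classic, continuous (cmap c \o k)}.
  apply/subspace_continuousP => r ruv.
  have kr : cdom c (k r) by apply/dom/kab; move: ruv; rewrite /= in_itv.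
  move/subspace_continuousP: ck => /(_ r ruv) ckr.
  exact: (cvg_comp _ _ ckr (chart_continuous kr)).
have k_inj : {in `[u, v] &, injective (cmap c \o k)}.
  move=> r t; rewrite !in_itv /= => ruv tuv rt.
  have {}rt : k r = k t by apply: (chart_inj _ _ rt); exact/dom/kab.
  have /andP[ur rv] := ruv; have /andP[ut tv] := tuv.
  by case: (ltgtP r t) => // h; [have := kmono _ _ ur h tv|have := kmono _ _ ut h rv]; rewrite rt ltxx.
have kP x y : (a <= x)%O -> (x < y)%O -> (y <= b)%O ->
    exists r t, [/\ r \in `[u, v], t \in `[u, v], r < t, k r = x & k t = y].
  move=> ax xy yb.
  have [|r ruv kr] := kS x; first by rewrite ax ltW// (lt_le_trans xy).
  have [|t tuv kt] := kS y; first by rewrite yb andbT ltW// (le_lt_trans ax).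
  exists r, t; rewrite !in_itv /=; split => //.
  have /andP[ur rv] := ruv; have /andP[ut tv] := tuv.
  case: (ltgtP r t) => // h; first by have := kmono _ _ ut h rv; rewrite kr kt ltNge ltW.
  by move: xy; rewrite -kr -kt h ltxx.
have [inc|dec] := itv_continuous_inj_mono cf k_inj.
  exists 1; first by rewrite expr1n.
  move=> x y ax xy yb; have [r [t [ruv tuv rt <- <-]]] := kP x y ax xy yb.
  by rewrite mul1r subr_gt0; exact: (inc r t).
exists (-1); first by rewrite sqrrN expr1n.
move=> x y ax xy yb; have [r [t [ruv tuv rt <- <-]]] := kP x y ax xy yb.
by rewrite mulN1r opprB subr_gt0; exact: (dec t r).
Qed.

(* [tangent_pos], for an arbitrary ordered space in place of the long ray. *)
Definition increasing_vec : set (tangent A) := [set v |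
  forall c, atlas A c -> cdom c (tbase v) -> \forall q \near tbase v,
    (tbase v < q)%O -> 0 < tcomp v c * (cmap c q - cmap c (tbase v))].

Section oriented_chart.
Variables (c : chart R L) (a b : L) (s : R).
Hypotheses (Ac : atlas A c) (dom : forall z, (a <= z <= b)%O -> cdom c z) (s2 : s ^+ 2 = 1)
  (smono : forall x y, (a <= x)%O -> (x < y)%O -> (y <= b)%O -> 0 < s * (cmap c y - cmap c x)).

(** One oriented chart decides: [chart_deriv_sign] carries the sign condition to all other
    charts. *)
Lemma increasing_vecP (v : tangent A) : (a <= tbase v)%O -> (tbase v < b)%O ->
  increasing_vec v <-> 0 < s * tcomp v c.
Proof.
move=> av vb; have cv : cdom c (tbase v) by apply: dom; rewrite av ltW.
split=> [vinc|sv].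
  have /nbhs_rayP-/(_ _ hL)[_ [b' vb' Ub']] := vinc c Ac cv.
  have [|q vq] := ray_dense hL (x := tbase v) (y := Order.min b b'); first by rewrite lt_min vb.
  rewrite lt_min => /andP[qb qb'].
  have h1 := Ub' q (ltW vq) qb' vq; have h2 := smono av vq (ltW qb).
  set D := (_ - _) in h1 h2.
  have D2 : 0 < D ^+ 2 by rewrite exprn_even_gt0//=; apply: contraTneq h1 => ->; rewrite mulr0 ltxx.
  by rewrite -(pmulr_lgt0 _ D2); have := mulr_gt0 h1 h2; congr (0 < _); ring.
move=> c' Ac' c'v.
have := chart_deriv_sign (atlas_compatible Ac Ac') (atlas_compatible Ac' Ac) cv c'v.
apply: filterS2 (near_ray_lt vb) => q qb + vq; rewrite gt_eqF// => /(_ isT) h1.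
have h2 := smono av vq (ltW qb).
rewrite (tcompE Ac Ac' cv c'v) -/(chart_deriv c c' (tbase v)).
set D := cmap c q - _ in h1 h2; set D' := cmap c' q - _ in h1 *.
have D2 : 0 < D ^+ 2 by rewrite exprn_even_gt0//=; apply: contraTneq h1 => ->; rewrite mulr0 ltxx.
rewrite -(pmulr_lgt0 _ D2); have := mulr_gt0 h1 (mulr_gt0 sv h2).
set K := chart_deriv _ _ _; set T := tcomp _ _.
have -> : K * D' * D * (s * T * (s * D)) = s ^+ 2 * (K * T * D' * D ^+ 2) by ring.
by rewrite s2 mul1r.
Qed.

End oriented_chart.

(** [psi (x, u)] is the vector over [x] with component [s * expR u]: in this logarithmic coordinate,
    scaling by [expR r] is translation by [r]. *)
Lemma chart_section y : exists a b (psi : L * R -> increasing_vec),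
  [/\ continuous psi, \forall z \near y, (a <= z <= b)%O,
    forall x u, (a <= x <= b)%O -> tbase (val (psi (x, u))) = x,
    forall x u r, val (psi (x, u + r)) = tscale (expR r) (val (psi (x, u))) &
    forall v : increasing_vec, (a <= tbase (val v) <= b)%O ->
      exists u, v = psi (tbase (val v), u)].
Proof.
have [c Ac cy] := atlas_cover A y.
have [a0 [b0 [a0y yb0 dom na0]]] := nbhs_ray_segment hL (open_nbhs_nbhs (conj (cdom_open c) cy)).
have [s s2 smono] := chart_monotone (le_lt_trans a0y yb0) dom.
(* The segment is shrunk to stay strictly below [b0], as [increasing_vecP] requires. *)
have [a [b [ay yb ab nab]]] := nbhs_ray_segment hL (filterI na0 (near_ray_lt yb0)).
have ab' : (a <= b)%O by rewrite ltW// (le_lt_trans ay).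
(* Clamping to the segment makes [psi] defined and continuous on all of [L * R]. *)
pose cl x := Order.max a (Order.min x b).
have clab x : (a <= cl x <= b)%O by rewrite /cl le_max lexx ge_max ab' ge_min lexx orbT.
have clE x : (a <= x <= b)%O -> cl x = x by move=> /andP[ax xb]; rewrite /cl min_l// max_r.
have cl0 x : (a0 <= cl x)%O /\ (cl x < b0)%O by have [/andP[]] := ab _ (clab x).
have clc x : cdom c (cl x) by apply: dom; have [-> /ltW] := cl0 x.
have s0 : s != 0 by rewrite -sqrf_eq0 s2 oner_eq0.
have /choice[psi psiP] : forall z : L * R, exists v : increasing_vec,
    tbase (val v) = cl z.1 /\ tcomp (val v) c = s * expR z.2.
  move=> [x u] /=; have [v [vx vc _]] := tangent_vec (s * expR u) Ac (clc x).
  have vinc : increasing_vec v.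
    apply/(increasing_vecP Ac dom s2 smono); rewrite ?vx; [exact: (cl0 x).1|exact: (cl0 x).2|].
    by rewrite vc mulrA -expr2 s2 mul1r expR_gt0.
  by exists (exist _ v (mem_set vinc)).
have psi_c z : cdom c (tbase (val (psi z))) by rewrite (psiP z).1.
exists a, b, psi; split.
- apply/continuousP => B [V oV <-].
  have [V' oV' V'E] : exists2 V' : set (R * R), open V' & forall v, cdom c (tbase v) ->
      V v <-> V' (cmap c (tbase v), tcomp v c) by exact: oV.
  pose h (z : L * R) : R * R := (cmap c (cl z.1), s * expR z.2).
  have -> : psi @^-1` (set_val @^-1` V) = h @^-1` V'.
    apply/seteqP; split => z /=; rewrite /h -(psiP z).1 -(psiP z).2.
      by move/(V'E _ (psi_c z)).
    by move=> hz; apply/(V'E _ (psi_c z)).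
  apply: open_comp => // z _.
  have h1 : (fun z : L * R => cmap c (cl z.1)) @ z --> cmap c (cl z.1).
    apply: (@continuous_comp _ _ _ fst (cmap c \o cl)); first exact: cvg_fst.
    apply: (@continuous_comp _ _ _ cl (cmap c)); last exact: chart_continuous.
    apply: max_fun_continuous; first exact: cst_continuous.
    by apply: min_fun_continuous; [by move=> w; exact: cvg_id|exact: cst_continuous].
  have h2 : (fun z : L * R => s * expR z.2) @ z --> s * expR z.2.
    apply: cvgM; first exact: cvg_cst.
    by apply: (@continuous_comp _ _ _ snd expR); [exact: cvg_snd|exact: continuous_expR].
  move=> U [[B1 B2] /= [zB1 zB2] BU].
  have n1 : \forall w \near z, B1 (cmap c (cl w.1)) := h1 _ zB1.
  have n2 : \forall w \near z, B2 (s * expR w.2) := h2 _ zB2.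
  by apply: filterS2 n1 n2 => w wB1 wB2; exact: BU.
- exact: nab.
- by move=> x u xab; rewrite (psiP (x, u)).1 /= clE.
- move=> x u r; apply: (tangent_eq_chart Ac (psi_c _)).
    by rewrite /= !(psiP _).1.
  by rewrite /= !(psiP _).2 /= expRD; ring.
- move=> v vab; have [/andP[a0v _] vb0] := ab _ vab.
  have : increasing_vec (val v) by exact: set_mem (valP v).
  move=> /(increasing_vecP Ac dom s2 smono a0v vb0) sv.
  exists (ln (s * tcomp (val v) c)); apply/val_inj/esym.
  apply: (tangent_eq_chart Ac (psi_c _)); first by rewrite (psiP _).1 /= clE.
  by rewrite (psiP _).2 /= lnK// mulrA -expr2 s2 mul1r.
Qed.

End ray_tangent.

(** * Homotopy classes *)

Section classes.
Variables (R : realType) (d : Order.disp_t) (L : orderTopologicalType d).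
Hypothesis hL : ray_like R L.
Variable A : smooth_structure R L.
Local Notation T := (@increasing_vec R d L A).

Definition base (v : T) : L := tbase (val v).

Lemma increasing_exp (r : R) (v : T) : increasing_vec (tscale (expR r) (val v)).
Proof.
move=> c Ac cv; have vinc : increasing_vec (val v) := set_mem (valP v).
apply: filterS (vinc c Ac cv) => q vq /vq.
by rewrite /= -mulrA; apply: mulr_gt0; exact: expR_gt0.
Qed.

(** Scaling in additive form; the action of the integers is by the multiples of [ln 2]. *)
Definition exp_scale (r : R) (v : T) : T := exist (fun w => w \in T) _ (mem_set (@increasing_exp r v)).

Lemma exp_scale0 v : exp_scale 0 v = v.
Proof. by apply/val_inj/tangent_ext => //= c; rewrite expR0 mul1r. Qed.

Lemma exp_scaleD r s v : exp_scale r (exp_scale s v) = exp_scale (r + s) v.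
Proof. by apply/val_inj/tangent_ext => //= c; rewrite expRD mulrA. Qed.

Lemma expR_mul_ln2 (i : int) : expR (i%:~R * ln 2) = 2 ^ i :> R.
Proof. by rewrite mulrC expRM lnK ?posrE// powR_intmul. Qed.

Lemma base_section (y : L) : exists a b (psi : L * R -> T),
  [/\ continuous psi, \forall z \near y, (a <= z <= b)%O,
    forall x u, (a <= x <= b)%O -> base (psi (x, u)) = x,
    forall x u r, psi (x, u + r) = exp_scale r (psi (x, u)) &
    forall v, (a <= base v <= b)%O -> exists u, v = psi (base v, u)].
Proof.
have [a [b [psi [cpsi nab bpsi spsi Ppsi]]]] := chart_section hL A y.
by exists a, b, psi; split => // x u r; apply: val_inj; rewrite spsi.
Qed.

Lemma base_surjective (y : L) : exists v, base v = y.
Proof.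
have [a [b [psi [_ nab bpsi _ _]]]] := base_section y.
by exists (psi (y, 0)); apply: bpsi; exact: nbhs_singleton nab.
Qed.

Lemma fiber_transitive (v w : T) : base v = base w -> exists r, w = exp_scale r v.
Proof.
have [a [b [psi [_ nab bpsi spsi Ppsi]]]] := base_section (base v).
have vab := nbhs_singleton nab; move=> vw.
have [u vE] := Ppsi v vab; have [u' wE] := Ppsi w ltac:(by rewrite -vw).
exists (u' - u); rewrite wE -vw {2}vE -spsi; congr (psi (_, _)); ring.
Qed.

Section invariant.
Variables (X : set T) (H : T -> R -> L).
Hypotheses (cX : closed X)
  (Xinv : forall v w (i : int), w = exp_scale (i%:~R * ln 2) v -> X w <-> X v)
  (Hinv : forall v w (i : int), w = exp_scale (i%:~R * ln 2) v -> forall t, H w t = H v t)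
  (cH : forall psi : L * R -> T, continuous psi ->
     (forall x u r, psi (x, u + r) = exp_scale r (psi (x, u))) ->
     continuous (fun z : L * R * R => H (psi z.1) z.2)).

(** This supplies the local compact parameters for [bounded_homotopy]: a segment of base points
    times the fundamental domain [0, ln 2] of the action, cut down to [X]. *)
Lemma base_local (y : L) : exists (K : set (L * R)) (pK : L * R -> L) (HK : L * R * R -> L),
  [/\ compact K, continuous pK, continuous HK,
    (forall k, K k -> exists2 x, X x & base x = pK k /\ forall t, H x t = HK (k, t)) &
    \forall z \near y, forall x, X x -> base x = z ->
      exists2 k, K k & pK k = base x /\ forall t, HK (k, t) = H x t].
Proof.
have [a [b [psi [cpsi nab bpsi spsi Ppsi]]]] := base_section y.
pose K : set (L * R) := ([set z | (a <= z <= b)%O] `*` `[0, ln 2]%classic) `&` (psi @^-1` X).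
exists K, fst, (fun z => H (psi z.1) z.2); split.
- apply: compact_closedI; last exact: ((continuous_closedP psi).1 cpsi _ cX).
  by apply: compact_setX; [exact: ray_segment_compact hL _ _|exact: segment_compact].
- by move=> z; exact: cvg_fst.
- exact: cH.
- by move=> [x u] [[/= xab _] Xpsi]; exists (psi (x, u)) => //; split => //; exact: bpsi.
apply: filterS nab => z zab v Xv vz; rewrite -vz in zab.
have [u vE] := Ppsi v zab.
have ln2 : 0 < ln 2 :> R by rewrite ln_gt0// ltr1n.
pose i := Num.floor (u / ln 2).
have /andP[iu ui] := floor_itv (u / ln 2).
rewrite ler_pdivlMr// in iu; rewrite ltr_pdivrMr// intrD mulrDl mul1r in ui.
have vE' : v = exp_scale (i%:~R * ln 2) (psi (base v, u - i%:~R * ln 2)).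
  by rewrite -spsi subrK.
exists (base v, u - i%:~R * ln 2); last by split => // t /=; rewrite (Hinv vE').
split; last exact/(Xinv vE').
by split => //=; rewrite in_itv /=; apply/andP; split; lra.
Qed.
End invariant.

(** * Maps to the ray from a quotient of the bundle *)

Variables (M : topologicalType) (q : T -> M) (pi : M -> L).
Hypotheses (cq : continuous q) (qS : forall m, exists v, q v = m)
  (qinv : forall v w (i : int), val w = tscale (2 ^ i) (val v) -> q w = q v)
  (cpi : continuous pi) (piq : forall v, pi (q v) = base v).

Lemma q_exp_scale v w (i : int) : w = exp_scale (i%:~R * ln 2) v -> q w = q v.
Proof. by move=> ->; apply: (qinv (i := i)); rewrite /= expR_mul_ln2. Qed.

Lemma q_exp_scale2 r v w (i : int) : w = exp_scale (i%:~R * ln 2) v ->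
  q (exp_scale r w) = q (exp_scale r v).
Proof.
move=> ->; apply: (qinv (i := i)); rewrite /= expR_mul_ln2.
by apply: tangent_ext => //= c; rewrite mulrCA.
Qed.

Section one_map.
Variable f : M -> L.
Hypothesis cf : continuous f.

Let cfq : continuous (f \o q).
Proof. by move=> v; apply: continuous_comp; [exact: cq|exact: cf]. Qed.

Let closed_le c : closed [set v | (f (q v) <= c)%O].
Proof. exact: ((continuous_closedP (f \o q)).1 cfq _ (@closed_ray_le _ _ c)). Qed.

Let closed_ge c : closed [set v | (c <= f (q v))%O].
Proof. exact: ((continuous_closedP (f \o q)).1 cfq _ (@closed_ray_ge _ _ c)). Qed.

(** The homotopy is [f] along the flow from [v] to [2 * v]; in the coordinates of [psi] the flow is
    an addition, hence continuous. *)
Let local_of (X : set T) : closed X ->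
  (forall v w (i : int), w = exp_scale (i%:~R * ln 2) v -> X w <-> X v) ->
  forall y : L, exists (K : set (L * R)) (pK : L * R -> L) (HK : L * R * R -> L),
  [/\ compact K, continuous pK, continuous HK,
    (forall k, K k -> exists2 x, X x & base x = pK k /\ forall t, f (q (exp_scale (t * ln 2) x)) = HK (k, t)) &
    \forall z \near y, forall x, X x -> base x = z ->
      exists2 k, K k & pK k = base x /\ forall t, HK (k, t) = f (q (exp_scale (t * ln 2) x))].
Proof.
move=> cX Xinv; apply: (base_local (H := fun x t => f (q (exp_scale (t * ln 2) x))) cX Xinv).
  by move=> v w i wE t; rewrite (q_exp_scale2 _ wE).
move=> psi cpsi spsi.
have -> : (fun z : L * R * R => f (q (exp_scale (z.2 * ln 2) (psi z.1)))) =
    (f \o q \o psi) \o (fun z : L * R * R => (z.1.1, z.1.2 + z.2 * ln 2)).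
  by apply/funext => -[[x u] t] /=; rewrite spsi.
move=> z; apply: continuous_comp; last first.
  by apply: continuous_comp; [exact: cpsi|exact: cfq].
have h1 : (fun z : L * R * R => z.1.1) @ z --> z.1.1.
  by apply: (@continuous_comp _ _ _ fst fst); exact: cvg_fst.
have h2 : (fun z : L * R * R => z.1.2 + z.2 * ln 2) @ z --> z.1.2 + z.2 * ln 2.
  apply: cvgD; first by apply: (@continuous_comp _ _ _ fst snd); [exact: cvg_fst|exact: cvg_snd].
  by apply: cvgM; [exact: cvg_snd|exact: cvg_cst].
move=> U [[B1 B2] /= [zB1 zB2] BU].
have n1 : \forall w \near z, B1 w.1.1 := h1 _ zB1.
have n2 : \forall w \near z, B2 (w.1.2 + w.2 * ln 2) := h2 _ zB2.
by apply: filterS2 n1 n2 => w wB1 wB2; exact: BU.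
Qed.

Lemma map_bounded_below a : exists b, forall m, (pi m <= a)%O -> (f m <= b)%O.
Proof.
have locT := local_of (X := setT) (@closedT T) (fun _ _ _ _ => iff_refl True).
have [b bP] := bounded_below hL locT a; exists b => m.
have [v <-] := qS m; rewrite piq => va.
have := bP v 0 I va; rewrite lexx ler01 => /(_ isT).
by rewrite mul0r exp_scale0.
Qed.

(** Otherwise the closed sets of base points carrying a value at most [c], respectively at least
    [e'], are both unbounded and share a point [y]. Flowing inside the fiber over [y] from the small
    value to the large one in time at most 1 contradicts rigidity. *)
Lemma unbounded_proper : (forall b, exists m, (b < f m)%O) ->
  forall c, exists b, forall m, (f m <= c)%O -> (pi m <= b)%O.
Proof.
move=> funb c; apply: contrapT => /forallNP N.
have {}N b : exists v, (f (q v) <= c)%O /\ (b < base v)%O.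
  apply: contrapT => N'; apply: (N b) => m; have [v <-] := qS m; rewrite piq => fc.
  by rewrite leNgt; apply/negP => bv; apply: N'; exists v.
pose X c' : set T := [set v | (f (q v) <= c')%O].
pose X' c' : set T := [set v | (c' <= f (q v))%O].
have Xinv c' v w (i : int) : w = exp_scale (i%:~R * ln 2) v -> X c' w <-> X c' v.
  by rewrite /X /= => /q_exp_scale ->.
have X'inv c' v w (i : int) : w = exp_scale (i%:~R * ln 2) v -> X' c' w <-> X' c' v.
  by rewrite /X' /= => /q_exp_scale ->.
have locX c' := local_of (closed_le (c := c')) (@Xinv c').
have locX' c' := local_of (closed_ge (c := c')) (@X'inv c').
have [|e eP] := bounded_homotopy hL (locX c) (c := c).
  by move=> v /=; rewrite mul0r exp_scale0.
have [e' ee'] := ray_nomax hL e.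
pose C (n : nat) := if n is 0%N then base @` X c else base @` X' e'.
have [||y Cy _] := @ray_club_bigcap R d L hL C _ _ e.
- by case=> [|n]; [exact: (@closed_base_image _ _ _ hL _ _ _ _ _ (locX c))|exact: (@closed_base_image _ _ _ hL _ _ _ _ _ (locX' e'))].
- case=> [|n] a.
    by have [v [vc av]] := N a; exists (base v) => //; exists v.
  have [b bP] := map_bounded_below a; have [m] := funb (Order.max b e').
  have [v <-] := qS m; rewrite gt_max => /andP[bv e'v].
  exists (base v); first by exists v => //; exact: ltW.
  by rewrite ltNge; apply/negP; rewrite -piq => /bP; rewrite leNgt bv.
have [v vc vy] := Cy 0%N I; have [w we wy] := Cy 1%N I.
have [r wE] : exists r, w = exp_scale r v by apply: fiber_transitive; rewrite vy.
have ln2 : 0 < ln 2 :> R by rewrite ln_gt0// ltr1n.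
(* The whole turns are invisible in the quotient, so only the fractional part of [r / ln 2] has to
   be flowed. *)
pose i := Num.floor (r / ln 2).
have /andP[ir ri] := floor_itv (r / ln 2).
have := eP v (r / ln 2 - i%:~R) vc.
rewrite subr_ge0 ir lerBlDr addrC -[1]/(1%:~R) -intrD (ltW ri) => /(_ isT).
have -> : q (exp_scale ((r / ln 2 - i%:~R) * ln 2) v) = q w.
  apply/esym/(q_exp_scale (i := i)); rewrite wE exp_scaleD; congr (exp_scale _ _); field.
  by rewrite gt_eqF.
by rewrite leNgt => /negP; apply; exact: lt_le_trans we.
Qed.

End one_map.

(** The time change [th] makes the homotopy continuous on all real times and lets it be run in
    either direction. *)
Lemma homotopy_bounded (h : M * R -> L) (th : R -> R) (c : L) :
  {within [set: M] `*` `[0, 1]%classic, continuous h} ->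
  continuous th -> (forall t, 0 <= th t <= 1) ->
  (forall m, (h (m, th 0) <= c)%O) -> exists b, forall m, (h (m, th 1) <= b)%O.
Proof.
move=> ch cth th01 h0c.
have Hinv v w (i : int) : w = exp_scale (i%:~R * ln 2) v ->
    forall t, h (q w, th t) = h (q v, th t).
  by move=> /q_exp_scale ->.
have cH (psi : L * R -> T) : continuous psi ->
    (forall x u r, psi (x, u + r) = exp_scale r (psi (x, u))) ->
    continuous (fun z : L * R * R => h (q (psi z.1), th z.2)).
  move=> cpsi _ z.
  pose D : set (M * R) := [set: M] `*` `[0, 1]%classic.
  pose g (z : L * R * R) : M * R := (q (psi z.1), th z.2).
  have gD w : D (g w) by split => //=; rewrite in_itv; exact: th01.
  have cg : g @ z --> within D (nbhs (g z)).
    have h1 : (fun z : L * R * R => q (psi z.1)) @ z --> q (psi z.1).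
      apply: (@continuous_comp _ _ _ fst (q \o psi)); first exact: cvg_fst.
      by apply: continuous_comp; [exact: cpsi|exact: cq].
    have h2 : (fun z : L * R * R => th z.2) @ z --> th z.2.
      by apply: (@continuous_comp _ _ _ snd th); [exact: cvg_snd|exact: cth].
    move=> U [[B1 B2] /= [zB1 zB2] BU].
    have n1 : \forall w \near z, B1 (q (psi w.1)) := h1 _ zB1.
    have n2 : \forall w \near z, B2 (th w.2) := h2 _ zB2.
    by apply: filterS2 n1 n2 => w wB1 wB2; apply: (BU (g w)).
  move/subspace_continuousP: ch => /(_ (g z) (gD z)) chz.
  exact: (cvg_comp _ _ cg chz).
have loc := base_local (X := setT) (@closedT T) (fun _ _ _ _ => iff_refl True) Hinv cH.
have [|b bP] := bounded_homotopy hL loc (c := c).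
  by move=> v _; exact: h0c.
by exists b => m; have [v <-] := qS m; apply: bP => //; rewrite lexx ler01.
Qed.

Lemma homotopic_bounded (f g : M -> L) : homotopic R f g ->
  (exists c, forall m, (f m <= c)%O) <-> (exists c, forall m, (g m <= c)%O).
Proof.
move=> [h [ch h0 h1]].
pose clamp (t : R) := Num.max 0 (Num.min t 1).
have cl01 t : 0 <= clamp t <= 1 by rewrite le_max lexx ge_max ler01 ge_min lexx orbT.
have cclamp : continuous clamp.
  apply: max_fun_continuous; first exact: cst_continuous.
  by apply: min_fun_continuous; [move=> w; exact: cvg_id|exact: cst_continuous].
have cl0 : clamp 0 = 0 by rewrite /clamp min_l// maxxx.
have cl1 : clamp 1 = 1 by rewrite /clamp minxx max_r.
split=> [[c fc]|[c gc]].
  have [m|b bP] := homotopy_bounded (c := c) ch cclamp cl01; first by rewrite cl0 h0.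
  by exists b => m; rewrite -h1 -cl1.
have cclamp' : continuous (fun t : R => clamp (1 - t)).
  move=> t; apply: (@continuous_comp _ _ _ (fun t : R => 1 - t) clamp); last exact: cclamp.
  by apply: cvgB; [exact: cvg_cst|exact: cvg_id].
have [m|b bP] := homotopy_bounded (c := c) ch cclamp' (fun t => cl01 (1 - t)).
  by rewrite subr0 cl1 h1.
by exists b => m; have := bP m; rewrite subrr cl0 h0.
Qed.

Lemma pi_unbounded b : exists m, (b < pi m)%O.
Proof.
have [y yb] := ray_nomax hL b; have [v vy] := base_surjective y.
by exists (q v); rewrite piq vy.
Qed.

Lemma unbounded_coarse (f : M -> L) : continuous f -> (forall b, exists m, (b < f m)%O) ->
  forall c, exists b, forall m,
  ((f m <= c)%O -> (pi m <= b)%O) /\ ((pi m <= c)%O -> (f m <= b)%O).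
Proof.
move=> cf uf c; have [b bP] := unbounded_proper cf uf c; have [b' b'P] := map_bounded_below cf c.
exists (Order.max b b') => m; rewrite !le_max.
by split=> [/bP|/b'P] ->; rewrite ?orbT.
Qed.

Lemma homotopicP (f g : M -> L) : continuous f -> continuous g ->
  homotopic R f g <->
  ((exists c, forall m, (f m <= c)%O) <-> (exists c, forall m, (g m <= c)%O)).
Proof.
move=> cf cg; split; first exact: homotopic_bounded.
have unb (h : M -> L) : ~ (exists c, forall m, (h m <= c)%O) -> forall b, exists m, (b < h m)%O.
  move=> N b; apply: contrapT => N'; apply: N; exists b => m; rewrite leNgt; apply/negP => hm.
  by apply: N'; exists m.
move=> fg; apply: (coarse_homotopic hL) => // c.
have [bf|/[dup] nbf /unb uf] := pselect (exists c, forall m, (f m <= c)%O).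
  have [b2 gb] := fg.1 bf; have [b1 fb] := bf.
  exists (Order.max b1 b2) => m; rewrite !le_max fb gb orbT.
  by split.
have ug : forall b, exists m, (b < g m)%O by apply: unb => /fg.
(* Two unbounded maps are compared through [pi], by composing the bounds. *)
have [b bP] := unbounded_coarse cf uf c; have [b' b'P] := unbounded_coarse cg ug c.
have [e eP] := unbounded_coarse cg ug b; have [e' e'P] := unbounded_coarse cf uf b'.
exists (Order.max e e') => m; rewrite !le_max; split.
  by move=> /(bP m).1 /(eP m).2 ->.
by move=> /(b'P m).1 /(e'P m).2 ->; rewrite orbT.
Qed.

Lemma homotopy_classes_card : (homotopy_classes R M L #= `I_2)%card.
Proof.
pose bounded (f : M -> L) := exists c, forall m, (f m <= c)%O.
(* Index 0 is the class of the bounded maps, represented by a constant, and 1 that of the unbounded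
   ones, represented by [pi]. *)
pose C (n : nat) := [set g : M -> L | continuous g /\ (bounded g <-> n = 0%N)].
have classE (f : M -> L) n : continuous f -> (bounded f <-> n = 0%N) ->
    [set g | continuous g /\ homotopic R f g] = C n.
  move=> cf bf; apply/seteqP; split=> g [cg fg]; split => //.
    by rewrite -bf; have [? ?] := (homotopicP cf cg).1 fg; split.
  by apply/(homotopicP cf cg); rewrite -/(bounded _) bf -/(bounded _) fg.
have [x0 _] := ray_inhabited hL.
have bcst : bounded (cst x0) by exists x0 => m.
have bpi : ~ bounded pi.
  by move=> [c pc]; have [m] := pi_unbounded c; rewrite ltNge pc.
rewrite card_eq_sym; apply/card_set_bijP; exists C; split.
- move=> n /=; rewrite ltnS leq_eqVlt ltnS leqn0 => /orP[/eqP ->|/eqP ->].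
    by exists pi => //; rewrite (classE _ 1%N).
  by exists (cst x0); [exact: cst_continuous|rewrite (classE _ 0%N)//; exact: cst_continuous].
- have C0 : C 0%N (cst x0) by split; [exact: cst_continuous|].
  have C1 : ~ C 1%N (cst x0) by move=> [_ [/(_ bcst)]].
  move=> [|[|m]] [|[|n]]; rewrite !inE //= => _ _ CC; exfalso; apply: C1.
    by rewrite -CC.
  by rewrite CC.
- move=> _ [f cf ->]; have [bf|bf] := pselect (bounded f).
    by exists 0%N => //; rewrite -(classE f 0%N).
  by exists 1%N => //; rewrite -(classE f 1%N).
Qed.
End classes.

(** * Application to the surface *)

Section surface_classes.
Local Open Scope quotient_scope.
Variables (R : realType) (d : Order.disp_t) (W : orderType d).
Hypothesis hW : is_omega1 W.
Variable A : smooth_structure R (long_ray R W).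

Definition surface_base (m : surface A) : long_ray R W := tbase (val (repr m)).

(** Scaling keeps the base point, and vectors identified by the collapse all lie over the least
    element. *)
Lemma surface_baseE (v : @tangent_pos R d W A) :
  surface_base (\pi_(surface A) v) = tbase (val v).
Proof.
have /eqmodP/asboolP[[i wv]|[v0 w0]] : repr (\pi_(surface A) v) = v %[mod surface A].
  by rewrite reprK.
- by have := congr1 (@tbase _ _ _) wv => /= ->.
- by apply/le_anti/andP; split; [exact: v0|exact: w0].
Qed.

Lemma surface_base_continuous : continuous surface_base.
Proof.
apply/quotient_continuous.
have -> : surface_base \o \pi_(surface A) = @tbase _ _ A \o val.
  by apply/funext => v /=; rewrite surface_baseE.
move=> v; apply: continuous_comp; last exact: tbase_continuous.
exact: (@initial_continuous _ _ (@set_val _ (@tangent_pos R d W A))).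
Qed.

Lemma surface_scale (v w : @tangent_pos R d W A) (i : int) :
  val w = tscale (2 ^ i) (val v) -> \pi_(surface A) w = \pi_(surface A) v.
Proof. by move=> wv; apply/esym/eqmodP/asboolP; left; exists i. Qed.

Lemma surface_card : (homotopy_classes R (surface A) (long_ray R W) #= `I_2)%card.
Proof.
apply: (homotopy_classes_card (long_ray_like R hW) (A := A)
  (q := \pi_(surface A) : @tangent_pos R d W A -> surface A) (pi := surface_base)).
- exact: (@pi_continuous _ {eq_quot (surface_equiv A)}).
- by move=> m; exists (repr m); rewrite reprK.
- exact: surface_scale.
- exact: surface_base_continuous.
- exact: surface_baseE.
Qed.
End surface_classes.

Local Open Scope classical_set_scope.
Local Open Scope card_scope.

Theorem theorem2 (R : realType) (d : Order.disp_t) (W : orderType d)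
    (hW : is_omega1 W) (A : smooth_structure R (long_ray R W)) :
  homotopy_classes R (surface A) (long_ray R W) #= `I_2.
Proof. exact: surface_card. Qed.
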